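(* Let $(R,\mathfrak m)$ be a commutative local quasi-Frobenius ring which is not a field, and let $X$ be an indeterminate over $R$. Then: (1) $\mathrm{Gwdim}(R[[X]])=1$; (2) $R[[X]]$ is not an arithmetical ring.
   Context: All rings are commutative with identity and all modules are unital. A ring is quasi-Frobenius if it is Noetherian and self-injective (injective as a module over itself). A ring is arithmetical if every finitely generated ideal is locally principal. An $R$-module $M$ is Gorenstein flat if there is an exact complex of flat $R$-modules $\cdots\to F_1\to F_0\to F^0\to F^1\to\cdots$ with $M\cong \mathrm{Im}(F_0\to F^0)$ that remains exact after applying $-\otimes_R I$ for every injective $R$-module $I$. The Gorenstein flat dimension $\mathrm{Gfd}_R(M)\in\{0,1,2,\dots\}\cup\{\infty\}$ is the least $n$ such that there is an exact sequence $0\to G_n\to\cdots\to G_0\to M\to 0$ with all $G_i$ Gorenstein flat ($\infty$ if there is none). The Gorenstein weak dimension of $R$ is $\mathrm{Gwdim}(R)=\sup\{\mathrm{Gfd}_R(M)\mid M \text{ an } R\text{-module}\}$. *)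

(* Defs.v *)
From HB Require Import structures.
From mathcomp Require Import all_boot all_order all_algebra ring.
From mathcomp Require Import boolp.

Set Implicit Arguments.
Unset Strict Implicit.
Unset Printing Implicit Defensive.

Import GRing.Theory.
Local Open Scope ring_scope.
Local Open Scope quotient_scope.

Section Ideals.
Variable R : comNzRingType.
Implicit Types I J m : {pred R}.

(* Unlike [idealr_closed] of ring_quotient, this allows the unit ideal. *)
Definition is_ideal I : Prop := GRing.submod_closed (I : {pred R^o}).

Definition ideal_gen (s : seq R) : {pred R} :=
  [pred x | `[< exists c : 'I_(size s) -> R, x = \sum_i c i * s`_i >]].

Definition principal_ideal I : Prop := exists a, I =i ideal_gen [:: a].

Definition maximal_ideal m : Prop :=
  idealr_closed m /\
  forall J, idealr_closed J -> {subset m <= J} -> J =i m.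

End Ideals.

Definition local_ring (R : comNzRingType) (m : {pred R}) : Prop :=
  maximal_ideal m /\ forall n : {pred R}, maximal_ideal n -> n =i m.

Definition is_field (R : comNzRingType) : Prop :=
  forall x : R, x != 0 -> exists y, y * x = 1.

Definition noetherian (R : comNzRingType) : Prop :=
  forall I : {pred R}, is_ideal I -> exists s : seq R, I =i ideal_gen s.

Definition injective_module (R : comNzRingType) (E : lmodType R) : Prop :=
  forall (A B : lmodType R) (f : {linear A -> B}) (g : {linear A -> E}),
    injective f -> exists h : {linear B -> E}, forall a, h (f a) = g a.

Definition quasi_Frobenius (R : comNzRingType) : Prop :=
  noetherian R /\ injective_module (R^o : lmodType R).

(* A formal power series is its sequence of coefficients, with the pointwise
   additive structure and the Cauchy product. *)
Definition powser (R : comNzRingType) : Type := nat -> R.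

Section PowerSeriesRing.
Variable R : comNzRingType.
Implicit Types f g h : powser R.

HB.instance Definition _ := gen_eqMixin (powser R).
HB.instance Definition _ := gen_choiceMixin (powser R).

Definition powser_zero : powser R := fun=> 0.
Definition powser_one : powser R := fun n => (n == 0%N)%:R.
Definition powser_opp f : powser R := fun n => - f n.
Definition powser_add f g : powser R := fun n => f n + g n.
Definition powser_mul f g : powser R :=
  fun n => \sum_(i < n.+1) f i * g (n - i)%N.

Let addA : associative powser_add.
Proof. by move=> f g h; apply/funext => n; apply: addrA. Qed.
Let addC : commutative powser_add.
Proof. by move=> f g; apply/funext => n; apply: addrC. Qed.
Let add0 : left_id powser_zero powser_add.
Proof. by move=> f; apply/funext => n; apply: add0r. Qed.
Let addN : left_inverse powser_zero powser_opp powser_add.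
Proof. by move=> f; apply/funext => n; apply: addNr. Qed.

HB.instance Definition _ := GRing.isZmodule.Build (powser R) addA addC add0 addN.

Let trunc N f : {poly R} := \poly_(i < N) f i.

Let mul_trunc N f g n : (n < N)%N ->
  powser_mul f g n = (trunc N f * trunc N g)`_n.
Proof.
move=> ltnN; rewrite coefM; apply: eq_bigr => i _; rewrite !coef_poly.
have lei : (i <= n)%N by rewrite -ltnS.
by rewrite (leq_ltn_trans lei ltnN) (leq_ltn_trans (leq_subr _ _) ltnN).
Qed.

Let mulC : commutative powser_mul.
Proof.
by move=> f g; apply/funext => n; rewrite !(mul_trunc _ _ (ltnSn n)) mulrC.
Qed.

Let mulA_coef f g h n :
  powser_mul (powser_mul f g) h n
  = (trunc n.+1 f * trunc n.+1 g * trunc n.+1 h)`_n.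
Proof.
rewrite coefM; apply: eq_bigr => i _.
rewrite (mul_trunc _ _ (ltn_ord i)); congr (_ * _).
by rewrite coef_poly ltnS leq_subr.
Qed.

Let mulA : associative powser_mul.
Proof.
move=> f g h; rewrite mulC; apply/funext => n.
by rewrite !mulA_coef [in LHS]mulrC mulrA.
Qed.

Let mul1 : left_id powser_one powser_mul.
Proof.
move=> f; apply/funext => n; rewrite /powser_mul big_ord_recl /= mul1r subn0.
by rewrite big1 ?addr0 // => i _; rewrite mul0r.
Qed.

Let mulDl : left_distributive powser_mul powser_add.
Proof.
move=> f g h; apply/funext => n; rewrite /powser_mul /powser_add -big_split.
by apply: eq_bigr => i _; rewrite mulrDl.
Qed.

Let one_neq0 : powser_one != powser_zero.
Proof.
by apply/eqP => /(congr1 (fun f : powser R => f 0%N)) /eqP; rewrite oner_eq0.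
Qed.

HB.instance Definition _ := GRing.Zmodule_isComNzRing.Build (powser R)
  mulA mulC mul1 mulDl one_neq0.

End PowerSeriesRing.

(* The localization R_P at a prime ideal P: fractions x / s with s outside P,
   where x / s = y / t iff u (x t - y s) = 0 for some u outside P. *)
Section Localization.
Variables (R : comNzRingType) (P : prime_idealr R).

Definition denom : Type := {s : R | s \notin (P : {pred R})}.
HB.instance Definition _ := Choice.on denom.

Let denom1_subproof : 1 \notin (P : {pred R}).
Proof. by rewrite idealr1. Qed.
Let denomM_subproof (s t : denom) : val s * val t \notin (P : {pred R}).
Proof. by rewrite prime_idealrM negb_or (valP s) (valP t). Qed.

Definition denom1 : denom := exist (fun s => is_true (s \notin (P : {pred R}))) 1 denom1_subproof.
Definition denomM (s t : denom) : denom :=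
  exist (fun s => is_true (s \notin (P : {pred R}))) (val s * val t)
        (denomM_subproof s t).

Definition loc_equiv (x y : R * denom) : bool :=
  `[< exists u : denom, val u * (x.1 * val y.2 - y.1 * val x.2) = 0 >].

Let loc_refl : reflexive loc_equiv.
Proof. by move=> x; apply/asboolP; exists denom1; rewrite subrr mulr0. Qed.

Let loc_sym : symmetric loc_equiv.
Proof.
move=> x y; apply/asboolP/asboolP => -[u e]; exists u.
  by rewrite -opprB mulrN e oppr0.
by rewrite -opprB mulrN e oppr0.
Qed.

Let loc_trans : transitive loc_equiv.
Proof.
move=> y x z /asboolP[u eu] /asboolP[v ev]; apply/asboolP.
exists (denomM (denomM u v) y.2) => /=.
have -> : val u * val v * val y.2 * (x.1 * val z.2 - z.1 * val x.2)
  = val v * val z.2 * (val u * (x.1 * val y.2 - y.1 * val x.2))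
    + val u * val x.2 * (val v * (y.1 * val z.2 - z.1 * val y.2)) by ring.
by rewrite eu ev !mulr0 addr0.
Qed.

Canonical loc_equivRel := EquivRel loc_equiv loc_refl loc_sym loc_trans.

Definition localization : Type := {eq_quot loc_equiv}.
HB.instance Definition _ := Choice.on localization.
HB.instance Definition _ : EqQuotient _ loc_equiv localization :=
  EqQuotient.on localization.

Definition locfrac (x : R) (s : denom) : localization := \pi_localization (x, s).

Lemma locfracP x s y t :
  locfrac x s = locfrac y t <->
  exists u : denom, val u * (x * val t - y * val s) = 0.
Proof.
by split=> [/eqmodP/asboolP//|e]; apply/eqmodP/asboolP.
Qed.

Lemma locfrac_surj (z : localization) : exists x s, z = locfrac x s.
Proof. by elim/quotW: z => -[x s]; exists x, s. Qed.

Definition loc_zero : localization := locfrac 0 denom1.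
Definition loc_one : localization := locfrac 1 denom1.
Definition loc_opp (z : localization) : localization :=
  locfrac (- (repr z).1) (repr z).2.
Definition loc_add (z w : localization) : localization :=
  locfrac ((repr z).1 * val (repr w).2 + (repr w).1 * val (repr z).2)
          (denomM (repr z).2 (repr w).2).
Definition loc_mul (z w : localization) : localization :=
  locfrac ((repr z).1 * (repr w).1) (denomM (repr z).2 (repr w).2).

Let repr_locfrac x s : exists u : denom,
  val u * ((repr (locfrac x s)).1 * val s) =
  val u * (x * val (repr (locfrac x s)).2).
Proof.
have /locfracP[u e] :
  locfrac (repr (locfrac x s)).1 (repr (locfrac x s)).2 = locfrac x s.
  by rewrite /locfrac -surjective_pairing reprK.
by exists u; apply/eqP; rewrite -subr_eq0 -mulrBr e.
Qed.

Lemma loc_oppE x s : loc_opp (locfrac x s) = locfrac (- x) s.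
Proof.
have [u e] := repr_locfrac x s; apply/locfracP; exists u.
by rewrite !mulNr -opprD mulrN mulrBr e subrr oppr0.
Qed.

Lemma loc_addE x s y t : loc_add (locfrac x s) (locfrac y t) =
  locfrac (x * val t + y * val s) (denomM s t).
Proof.
have [u] := repr_locfrac x s; have [v] := repr_locfrac y t.
rewrite /loc_add; case: (repr (locfrac x s)) => a b /=.
case: (repr (locfrac y t)) => c d /= ev eu.
apply/locfracP; exists (denomM u v) => /=.
have -> : val u * val v * ((a * val d + c * val b) * (val s * val t)
                           - (x * val t + y * val s) * (val b * val d))
  = (val u * (a * val s) - val u * (x * val b)) * (val v * val d * val t)
    + (val v * (c * val t) - val v * (y * val d)) * (val u * val b * val s).
  by ring.
by rewrite eu ev !subrr !mul0r addr0.
Qed.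

Lemma loc_mulE x s y t :
  loc_mul (locfrac x s) (locfrac y t) = locfrac (x * y) (denomM s t).
Proof.
have [u] := repr_locfrac x s; have [v] := repr_locfrac y t.
rewrite /loc_mul; case: (repr (locfrac x s)) => a b /=.
case: (repr (locfrac y t)) => c d /= ev eu.
apply/locfracP; exists (denomM u v) => /=.
have -> : val u * val v * (a * c * (val s * val t) - x * y * (val b * val d))
  = (val u * (a * val s)) * (val v * (c * val t))
    - (val u * (x * val b)) * (val v * (y * val d)) by ring.
by rewrite eu ev subrr.
Qed.

Lemma locfrac_eq x s y t : x * val t = y * val s -> locfrac x s = locfrac y t.
Proof. by move=> e; apply/locfracP; exists denom1; rewrite e subrr mulr0. Qed.

Let addA : associative loc_add.
Proof.
move=> z w v; have [x [s ->]] := locfrac_surj z.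
have [y [t ->]] := locfrac_surj w; have [a [b ->]] := locfrac_surj v.
by rewrite !loc_addE; apply: locfrac_eq => /=; ring.
Qed.

Let addC : commutative loc_add.
Proof.
move=> z w; have [x [s ->]] := locfrac_surj z.
have [y [t ->]] := locfrac_surj w; rewrite !loc_addE.
by apply: locfrac_eq => /=; rewrite addrC [val t * _]mulrC.
Qed.

Let add0 : left_id loc_zero loc_add.
Proof.
move=> z; have [x [s ->]] := locfrac_surj z.
by rewrite loc_addE; apply: locfrac_eq => /=; rewrite mul0r add0r mulr1 mul1r.
Qed.

Let addN : left_inverse loc_zero loc_opp loc_add.
Proof.
move=> z; have [x [s ->]] := locfrac_surj z.
rewrite loc_oppE loc_addE; apply: locfrac_eq => /=.
by rewrite mulNr addNr !mul0r.
Qed.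

HB.instance Definition _ := GRing.isZmodule.Build localization addA addC add0 addN.

Let mulA : associative loc_mul.
Proof.
move=> z w v; have [x [s ->]] := locfrac_surj z.
have [y [t ->]] := locfrac_surj w; have [a [b ->]] := locfrac_surj v.
by rewrite !loc_mulE; apply: locfrac_eq => /=; rewrite !mulrA.
Qed.

Let mulC : commutative loc_mul.
Proof.
move=> z w; have [x [s ->]] := locfrac_surj z.
have [y [t ->]] := locfrac_surj w; rewrite !loc_mulE.
by apply: locfrac_eq => /=; rewrite [x * y]mulrC [val t * _]mulrC.
Qed.

Let mul1 : left_id loc_one loc_mul.
Proof.
move=> z; have [x [s ->]] := locfrac_surj z.
by rewrite loc_mulE; apply: locfrac_eq => /=; rewrite !mul1r.
Qed.

Let mulDl : left_distributive loc_mul loc_add.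
Proof.
move=> z w v; have [x [s ->]] := locfrac_surj z.
have [y [t ->]] := locfrac_surj w; have [a [b ->]] := locfrac_surj v.
by rewrite !(loc_mulE, loc_addE); apply: locfrac_eq => /=; ring.
Qed.

Let one_neq0 : loc_one != loc_zero.
Proof.
apply/eqP => /locfracP[[u /= uP]]; rewrite mul0r subr0 !mulr1 => u0.
by rewrite u0 idealr0 in uP.
Qed.

HB.instance Definition _ := GRing.Zmodule_isComNzRing.Build localization
  mulA mulC mul1 mulDl one_neq0.

Definition loc_ideal (I : {pred R}) : {pred localization} :=
  [pred z | `[< exists x s, x \in I /\ z = locfrac x s >]].

End Localization.
Arguments loc_ideal {R} P I.

Definition arithmetical (R : comNzRingType) : Prop :=
  forall (s : seq R) (P : prime_idealr R), principal_ideal (loc_ideal P (ideal_gen s)).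

(* M (x) N consists of the formal sums of pairs (m, n), two of them being
   identified when every bilinear map takes the same value on both. *)
Section Tensor.
Variables (R : comNzRingType) (M N : lmodType R).

Definition formal_eval (Q : lmodType R) (b : M -> N -> Q) (s : seq (M * N)) : Q :=
  \sum_(p <- s) b p.1 p.2.

Definition tensor_equiv (s t : seq (M * N)) : bool :=
  `[< forall (Q : lmodType R) (b : {bilinear M -> N -> Q}),
        formal_eval b s = formal_eval b t >].

Let tensor_refl : reflexive tensor_equiv.
Proof. by move=> s; apply/asboolP. Qed.
Let tensor_sym : symmetric tensor_equiv.
Proof. by move=> s t; apply/asboolP/asboolP => e Q b; rewrite e. Qed.
Let tensor_trans : transitive tensor_equiv.
Proof.
by move=> t s u /asboolP e /asboolP e'; apply/asboolP => Q b; rewrite e.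
Qed.

Canonical tensor_equivRel :=
  EquivRel tensor_equiv tensor_refl tensor_sym tensor_trans.

Definition tensor : Type := {eq_quot tensor_equiv}.
HB.instance Definition _ := Choice.on tensor.
HB.instance Definition _ : EqQuotient _ tensor_equiv tensor :=
  EqQuotient.on tensor.

Definition formal_scale (a : R) (s : seq (M * N)) : seq (M * N) :=
  [seq (a *: p.1, p.2) | p <- s].

Definition tensor_zero : tensor := \pi_tensor [::].
Definition tensor_add (x y : tensor) : tensor := \pi_tensor (repr x ++ repr y).
Definition tensor_scale (a : R) (x : tensor) : tensor :=
  \pi_tensor (formal_scale a (repr x)).
Definition tensor_opp (x : tensor) : tensor := tensor_scale (-1) x.

Lemma tensor_piP (s t : seq (M * N)) :
  \pi_tensor s = \pi_tensor t <->
  forall (Q : lmodType R) (b : {bilinear M -> N -> Q}),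
    formal_eval b s = formal_eval b t.
Proof. by split=> [/eqmodP/asboolP|e]; [|apply/eqmodP/asboolP]. Qed.

Lemma formal_eval_repr (Q : lmodType R) (b : {bilinear M -> N -> Q}) s :
  formal_eval b (repr (\pi_tensor s)) = formal_eval b s.
Proof.
have /tensor_piP : \pi_tensor (repr (\pi_tensor s)) = \pi_tensor s by rewrite reprK.
exact.
Qed.

Lemma formal_eval_cat (Q : lmodType R) (b : M -> N -> Q) s t :
  formal_eval b (s ++ t) = formal_eval b s + formal_eval b t.
Proof. exact: big_cat. Qed.

Lemma formal_eval_scale (Q : lmodType R) (b : {bilinear M -> N -> Q}) a s :
  formal_eval b (formal_scale a s) = a *: formal_eval b s.
Proof.
rewrite /formal_eval big_map scaler_sumr; apply: eq_bigr => p _.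
exact: linearZl_LR.
Qed.

Let tensor_addA : associative tensor_add.
Proof.
move=> x y z; apply/tensor_piP => Q b.
by rewrite !(formal_eval_cat, formal_eval_repr) addrA.
Qed.
Let tensor_addC : commutative tensor_add.
Proof.
by move=> x y; apply/tensor_piP => Q b; rewrite !formal_eval_cat addrC.
Qed.
Let tensor_add0 : left_id tensor_zero tensor_add.
Proof.
move=> x; rewrite -[RHS]reprK; apply/tensor_piP => Q b.
by rewrite formal_eval_cat formal_eval_repr /formal_eval big_nil add0r.
Qed.
Let tensor_addN : left_inverse tensor_zero tensor_opp tensor_add.
Proof.
move=> x; apply/tensor_piP => Q b.
rewrite formal_eval_cat formal_eval_repr formal_eval_scale scaleN1r addNr.
by rewrite /formal_eval big_nil.
Qed.

HB.instance Definition _ :=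
  GRing.isZmodule.Build tensor tensor_addA tensor_addC tensor_add0 tensor_addN.

Let tensor_scaleA a b (x : tensor) :
  tensor_scale a (tensor_scale b x) = tensor_scale (a * b) x.
Proof.
apply/tensor_piP => Q f.
by rewrite !(formal_eval_scale, formal_eval_repr) scalerA.
Qed.
Let tensor_scale1 : left_id 1 tensor_scale.
Proof.
move=> x; rewrite -[RHS]reprK; apply/tensor_piP => Q b.
by rewrite formal_eval_scale scale1r.
Qed.
Let tensor_scaleDr : right_distributive tensor_scale +%R.
Proof.
move=> a x y; apply/tensor_piP => Q b.
by rewrite !(formal_eval_scale, formal_eval_cat, formal_eval_repr) scalerDr.
Qed.
Let tensor_scaleDl (x : tensor) : {morph tensor_scale^~ x : a b / a + b}.
Proof.
move=> a b; apply/tensor_piP => Q f.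
by rewrite !(formal_eval_scale, formal_eval_cat, formal_eval_repr) scalerDl.
Qed.

HB.instance Definition _ := GRing.Zmodule_isLmodule.Build R tensor
  tensor_scaleA tensor_scale1 tensor_scaleDr tensor_scaleDl.

Definition tensor_pure (m : M) (n : N) : tensor := \pi_tensor [:: (m, n)].

Lemma formal_eval1 (Q : lmodType R) (b : M -> N -> Q) m n :
  formal_eval b [:: (m, n)] = b m n.
Proof. exact: big_seq1. Qed.

Let tensor_pure_bilinear :
  bilinear_for (GRing.Scale.Law.clone _ _ ( *:%R ) _)
               (GRing.Scale.Law.clone _ _ ( *:%R ) _) tensor_pure.
Proof.
split=> [n a m m'|m a n n']; apply/tensor_piP => Q b;
  rewrite formal_eval_cat !formal_eval_repr formal_eval_scale formal_eval_repr.
  by rewrite !formal_eval1 linearPl.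
by rewrite !formal_eval1 linearPr.
Qed.

HB.instance Definition _ := bilinear_isBilinear.Build R M N tensor
  (GRing.Scale.Law.clone _ _ ( *:%R ) _) (GRing.Scale.Law.clone _ _ ( *:%R ) _)
  tensor_pure tensor_pure_bilinear.

Lemma tensor_pi_sum (s : seq (M * N)) :
  \pi_tensor s = \sum_(p <- s) tensor_pure p.1 p.2.
Proof.
elim: s => [|[m n] s IHs]; first by rewrite big_nil.
rewrite big_cons -IHs; apply/tensor_piP => Q b.
by rewrite formal_eval_cat !formal_eval_repr -formal_eval_cat.
Qed.

Section Lift.
Variables (Q : lmodType R) (b : {bilinear M -> N -> Q}).

Definition tensor_lift (x : tensor) : Q := formal_eval b (repr x).

Let tensor_lift_linear : linear tensor_lift.
Proof.
move=> a x y; rewrite /tensor_lift formal_eval_repr formal_eval_cat.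
by rewrite formal_eval_repr formal_eval_scale.
Qed.

HB.instance Definition _ :=
  GRing.isLinear.Build R tensor Q _ tensor_lift tensor_lift_linear.

Lemma tensor_lift_pure m n : tensor_lift (tensor_pure m n) = b m n.
Proof. by rewrite /tensor_lift formal_eval_repr formal_eval1. Qed.

Lemma tensor_lift_unique (f : {linear tensor -> Q}) :
  (forall m n, f (tensor_pure m n) = b m n) -> f =1 tensor_lift.
Proof.
move=> fb x; rewrite -[x in LHS]reprK tensor_pi_sum linear_sum.
by apply: eq_bigr => p _; rewrite fb.
Qed.

End Lift.
End Tensor.

Section TensorMap.
Variables (R : comNzRingType) (M M' N : lmodType R) (f : {linear M -> M'}).

Definition map_pure (m : M) (n : N) : tensor M' N := tensor_pure (f m) n.

Let map_pure_bilinear :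
  bilinear_for (GRing.Scale.Law.clone _ _ ( *:%R ) _)
               (GRing.Scale.Law.clone _ _ ( *:%R ) _) map_pure.
Proof.
split=> [n a m m'|m a n n']; rewrite /map_pure /applyr.
  by rewrite linearP linearPl.
by rewrite linearPr.
Qed.

HB.instance Definition _ := bilinear_isBilinear.Build R M N (tensor M' N)
  (GRing.Scale.Law.clone _ _ ( *:%R ) _) (GRing.Scale.Law.clone _ _ ( *:%R ) _)
  map_pure map_pure_bilinear.

(* f (x) id_N *)
Definition tensor_map : {linear tensor M N -> tensor M' N} := tensor_lift map_pure.

End TensorMap.

Definition exact_at (R : comNzRingType) (A B C : lmodType R)
    (f : {linear A -> B}) (g : {linear B -> C}) : Prop :=
  forall y, g y = 0 <-> exists x, f x = y.

Definition flat (R : comNzRingType) (F : lmodType R) : Prop :=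
  forall (A B C : lmodType R) (f : {linear A -> B}) (g : {linear B -> C}),
    exact_at f g -> exact_at (tensor_map F f) (tensor_map F g).

(* ... -> F_1 -> F_0 -> F^0 -> F^1 -> ... *)
Record two_sided_seq (R : comNzRingType) := TwoSidedSeq {
  lower : nat -> lmodType R;
  upper : nat -> lmodType R;
  lower_map : forall n, {linear lower n.+1 -> lower n};
  middle_map : {linear lower 0%N -> upper 0%N};
  upper_map : forall n, {linear upper n -> upper n.+1}
}.

Definition two_sided_exact (R : comNzRingType) (F : two_sided_seq R) : Prop :=
  [/\ forall n, exact_at (lower_map F n.+1) (lower_map F n),
      exact_at (lower_map F 0) (middle_map F),
      exact_at (middle_map F) (upper_map F 0) &
      forall n, exact_at (upper_map F n) (upper_map F n.+1)].

Definition two_sided_tensor (R : comNzRingType) (F : two_sided_seq R)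
    (N : lmodType R) : two_sided_seq R :=
  {| lower n := tensor (lower F n) N;
     upper n := tensor (upper F n) N;
     lower_map n := tensor_map N (lower_map F n);
     middle_map := tensor_map N (middle_map F);
     upper_map n := tensor_map N (upper_map F n) |}.

Definition Gorenstein_flat (R : comNzRingType) (M : lmodType R) : Prop :=
  exists F : two_sided_seq R,
    [/\ forall n, flat (lower F n),
        forall n, flat (upper F n),
        two_sided_exact F,
        (* M is isomorphic to the image of F_0 -> F^0 *)
        exists j : {linear M -> upper F 0%N}, injective j /\
          forall y, (exists m, j m = y) <-> (exists x, middle_map F x = y) &
        forall I : lmodType R, injective_module I ->
          two_sided_exact (two_sided_tensor F I)].

(* An exact sequence 0 -> G_n -> ... -> G_0 -> M -> 0 of Gorenstein flat
   modules, extended by G_i = 0 for i > n. *)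
Definition has_Gflat_resolution (R : comNzRingType) (M : lmodType R) (n : nat) : Prop :=
  exists (G : nat -> lmodType R) (d : forall i, {linear G i.+1 -> G i})
         (e : {linear G 0%N -> M}),
    [/\ forall i, (i <= n)%N -> Gorenstein_flat (G i),
        forall i, (n < i)%N -> forall x : G i, x = 0,
        forall i, exact_at (d i.+1) (d i),
        exact_at (d 0%N) e &
        forall m, exists x, e x = m].

(* Values in {0, 1, 2, ...} + {oo}, with None standing for oo. *)
Definition least (P : nat -> Prop) : option nat :=
  if pselect (exists n, `[< P n >]) is left exP then Some (ex_minn exP) else None.

Lemma leastP (P : nat -> Prop) n :
  least P = Some n <-> P n /\ forall k, P k -> (n <= k)%N.
Proof.
rewrite /least; case: pselect => [exP|nP]; last first.
  by split=> // -[Pn _]; case: nP; exists n; apply/asboolP.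
case: ex_minnP => i /asboolP Pi imin; split=> [[<-]|[Pn nmin]].
  by split=> // k Pk; apply/imin/asboolP.
by congr Some; apply/eqP; rewrite eqn_leq nmin // imin //; apply/asboolP.
Qed.

Definition le_option (k : option nat) (n : nat) : Prop :=
  if k is Some i then (i <= n)%N else False.

Definition Gfd (R : comNzRingType) (M : lmodType R) : option nat :=
  least (has_Gflat_resolution M).

(* A supremum in {0, 1, 2, ...} + {oo} is the least finite upper bound, and is
   oo when there is none. *)
Definition Gwdim (R : comNzRingType) : option nat :=
  least (fun n => forall M : lmodType R, le_option (Gfd M) n).

(* Main.v *)
Require Import Defs.
From HB Require Import structures.
From mathcomp Require Import all_boot all_order all_algebra.
From mathcomp Require Import boolp classical_sets functions.

(** Write S for the ring of power series over R, and X for the variable.  The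
engine of the proof is that X-regular S-modules (those on which X acts
injectively) play the role of maximal Cohen-Macaulay modules over the
one-dimensional Gorenstein ring S; everything about them reduces to R by looking
at one coefficient of X at a time.

Self-injectivity of R enters through [extend_linear].  Let A be an X-saturated
submodule of an S-module B.  An S-linear map B -> S is a sequence of R-linear
maps phi_n : B -> R with phi_{n+1} (X b) = phi_n b and phi_0 (X b) = 0, so that a
given map A -> S and the map phi_n prescribe phi_{n+1} on A + X B; saturation makes
this prescription consistent, and R being injective it extends to B.  This is
the vanishing of Ext(M, S) for X-regular M.  The noetherian hypothesis enters
through [saturated_fg]: an X-saturated submodule of S^n is finitely generated,
because generators of its reduction modulo X, which lives in R^n, can be lifted
and coefficients can be solved for successively.

From these two facts one gets, for an X-regular module M:
- Tor_1(M, I) = 0 for every injective I ([tensor_injective]): a zero tensor is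
  witnessed by finitely many equations, which generate X-saturated, hence
  finitely generated, modules of relations; dualising those into S stays exact by
  the extension property, and dualising once more into I stays exact because I
  is injective;
- M embeds in a flat module with X-regular cokernel ([evaluation_inj],
  [evaluation_coker_regular]).  A finitely generated X-regular module embeds in a
  power of S, because functionals detect divisibility by X
  ([functionals_detect]) and nothing nonzero is divisible by all powers of X
  ([krull]).  A general M, for instance the module of Laurent series, may
  have no nonzero functional, so the embeddings of its finitely generated
  submodules are glued in a reduced product of copies of S, which is flat because
  relations between power series are finitely generated.

Splicing free covers on the left with these embeddings on the right gives a
complete flat resolution, so every X-regular module is Gorenstein flat
([X_regular_Gorenstein_flat]).  The kernel of a free cover of an arbitrary module
is X-regular, hence Gwdim S is at most 1; conversely a Gorenstein flat module lies
in a flat one and is X-regular, which S/XS is not, hence Gwdim S is not 0.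

For the second assertion, take a nonzero nonunit a of R.  If the ideal (a, X)
were principal at the maximal ideal, generated by x, then comparing the
coefficients of degree 0 and 1 in the equation expressing X through x would force
x_0 = 0, and then the equation expressing a through x would give a = 0. *)

Set Implicit Arguments.
Unset Strict Implicit.
Unset Printing Implicit Defensive.

Import GRing.Theory.
Local Open Scope ring_scope.
Local Open Scope quotient_scope.

(** * Submodules, quotients and injectivity *)

(** Submodules are Prop-valued, so that any closed condition gives one; the
boolean predicate [sub_pred] serves only to reuse the generic subtype and quotient
constructions. *)
Record submodule (R : comNzRingType) (V : lmodType R) := Submodule {
  in_sub :> V -> Prop;
  in_sub0 : in_sub 0;
  in_subP : forall a x y, in_sub x -> in_sub y -> in_sub (a *: x + y)
}.

Section Submodule.
Variables (R : comNzRingType) (V : lmodType R) (N : submodule V).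

Definition sub_pred : {pred V} := fun x => `[< N x >].

Lemma sub_predP x : reflect (N x) (x \in sub_pred).
Proof. exact: asboolP. Qed.

Let sub_pred_closed : GRing.subsemimod_closed sub_pred.
Proof.
apply: GRing.submod_closed_semi; split; first exact/sub_predP/in_sub0.
by move=> a x y /sub_predP Nx /sub_predP Ny; apply/sub_predP/in_subP.
Qed.

HB.instance Definition _ := GRing.isSubmodClosed.Build R V sub_pred sub_pred_closed.

Lemma in_subD x y : N x -> N y -> N (x + y).
Proof. by move=> Nx Ny; rewrite -[x]scale1r; apply: in_subP. Qed.

Lemma in_subZ a x : N x -> N (a *: x).
Proof. by move=> Nx; rewrite -[_ *: _]addr0; apply/in_subP/in_sub0. Qed.

Lemma in_subN x : N x -> N (- x).
Proof. by rewrite -scaleN1r; apply: in_subZ. Qed.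

Lemma in_subB x y : N x -> N y -> N (x - y).
Proof. by move=> Nx /in_subN; apply: in_subD. Qed.

Lemma in_sub_sum I (r : seq I) (P : pred I) (F : I -> V) :
  (forall i, P i -> N (F i)) -> N (\sum_(i <- r | P i) F i).
Proof. by move=> NF; elim/big_ind: _ => //; [apply: in_sub0|apply: in_subD]. Qed.

Definition sub_mod : Type := {x : V | x \in sub_pred}.
HB.instance Definition _ := SubChoice.on sub_mod.
HB.instance Definition _ := [SubChoice_isSubLmodule of sub_mod by <:].

Definition sub_val : sub_mod -> V := val.
HB.instance Definition _ := GRing.Linear.on sub_val.

Lemma sub_valZ a (x : sub_mod) : sub_val (a *: x) = a *: sub_val x.
Proof. by []. Qed.

Lemma sub_val_in (x : sub_mod) : N (sub_val x).
Proof. exact/sub_predP/(valP x). Qed.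

Lemma sub_valP v : N v -> exists x : sub_mod, sub_val x = v.
Proof. by move=> /sub_predP Nv; exists (Sub v Nv); apply: SubK. Qed.

Lemma sub_val_inj : injective sub_val.
Proof. exact: val_inj. Qed.

Definition quot_mod : Type := Quotient.quot sub_pred.
HB.instance Definition _ := GRing.Zmodule.on quot_mod.

Definition quot_pi (v : V) : quot_mod := \pi_(Quotient.quot sub_pred) v.

Lemma quot_pi_eq v w : quot_pi v = quot_pi w <-> N (v - w).
Proof.
split=> [/eqP|/sub_predP]; rewrite /quot_pi.
  by rewrite -Quotient.idealrBE => /sub_predP.
by rewrite Quotient.idealrBE => /eqP.
Qed.

Lemma quot_piP (q : quot_mod) : exists v, q = quot_pi v.
Proof. by exists (repr q); rewrite /quot_pi reprK. Qed.

Definition quot_scale (a : R) (q : quot_mod) : quot_mod :=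
  quot_pi (a *: (repr q : V)).

Let quot_piD : {morph quot_pi : x y / x + y}.
Proof. by move=> x y; rewrite /quot_pi raddfD. Qed.

Let quot_piZ a v : quot_scale a (quot_pi v) = quot_pi (a *: v).
Proof.
apply/quot_pi_eq; rewrite -scalerBr; apply/in_subZ/quot_pi_eq.
by rewrite /quot_pi reprK.
Qed.

Let scaleA a b q : quot_scale a (quot_scale b q) = quot_scale (a * b) q.
Proof. by have [v ->] := quot_piP q; rewrite !quot_piZ scalerA. Qed.
Let scale1 : left_id 1 quot_scale.
Proof. by move=> q; have [v ->] := quot_piP q; rewrite !quot_piZ scale1r. Qed.
Let scaleDr : right_distributive quot_scale +%R.
Proof.
move=> a q q'; have [v ->] := quot_piP q; have [v' ->] := quot_piP q'.
by rewrite -quot_piD !quot_piZ -quot_piD scalerDr.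
Qed.
Let scaleDl q : {morph quot_scale^~ q : a b / a + b}.
Proof.
by move=> a b; have [v ->] := quot_piP q; rewrite !quot_piZ -quot_piD scalerDl.
Qed.

HB.instance Definition _ := GRing.Zmodule_isLmodule.Build R quot_mod
  scaleA scale1 scaleDr scaleDl.

Let quot_pi_linear : linear quot_pi.
Proof. by move=> a v w; rewrite quot_piD -quot_piZ. Qed.

HB.instance Definition _ :=
  GRing.isLinear.Build R V quot_mod _ quot_pi quot_pi_linear.

Lemma quot_pi0 v : quot_pi v = 0 <-> N v.
Proof. by rewrite -(raddf0 quot_pi) quot_pi_eq subr0. Qed.

End Submodule.

Arguments sub_val {R V N}.
Arguments quot_pi {R V} N.

Section Kernel.
Variables (R : comNzRingType) (V W : lmodType R) (f : {linear V -> W}).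

Let kernelP a x y : f x = 0 -> f y = 0 -> f (a *: x + y) = 0.
Proof. by move=> fx fy; rewrite linearP fx fy scaler0 addr0. Qed.

Definition kernel : submodule V :=
  @Submodule R V (fun x => f x = 0) (raddf0 f) kernelP.

Let range0 : exists x, f x = 0.
Proof. by exists 0; rewrite raddf0. Qed.

Let rangeP a y z : (exists x, f x = y) -> (exists x, f x = z) ->
  exists x, f x = a *: y + z.
Proof. by move=> [x <-] [x' <-]; exists (a *: x + x'); rewrite linearP. Qed.

Definition range_sub : submodule W :=
  @Submodule R W (fun y => exists x, f x = y) range0 rangeP.

Lemma exact_kernel : exact_at (sub_val : {linear sub_mod kernel -> V}) f.
Proof.
move=> y; split=> [fy0|[x <-]]; last exact: (sub_val_in x).
exact: (@sub_valP _ _ kernel).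
Qed.

Lemma exact_cokernel : exact_at f (quot_pi range_sub).
Proof. by move=> y; rewrite quot_pi0. Qed.
End Kernel.

(** Injectivity for a linear map that is only defined on a submodule of [B]: the
map is given by its graph [G], itself a submodule of [B * E], and single-valuedness
at 0 says that the first projection of the graph is injective.  With graphs the
value need not be chosen among the representations of an argument. *)
Lemma injective_graph (R : comNzRingType) (E B : lmodType R) (G : B -> E -> Prop) :
  injective_module E -> G 0 0 ->
  (forall a x y v w, G x v -> G y w -> G (a *: x + y) (a *: v + w)) ->
  (forall v : E, G 0 v -> v = 0) ->
  exists h : {linear B -> E}, forall x v, G x v -> h x = v.
Proof.
move=> Einj G0 GP Gfun.
pose N := @Submodule R (B * E)%type (fun p => G p.1 p.2) G0
  (fun a p q Gp Gq => GP a p.1 q.1 p.2 q.2 Gp Gq).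
pose f : {linear sub_mod N -> B} := fst \o sub_val.
pose g : {linear sub_mod N -> E} := snd \o sub_val.
have f_inj : injective f.
  move=> p q e; apply: sub_val_inj; apply/eqP; rewrite -subr_eq0; apply/eqP.
  have := sub_val_in (p - q); rewrite raddfB => Gpq.
  have e0 : (sub_val p - sub_val q).1 = 0 by rewrite /= [(sub_val p).1]e subrr.
  by case: (_ - _) e0 Gpq => x v /= -> /(Gfun v) ->.
have [h hP] := Einj _ _ f g f_inj.
exists h => x v Gxv; have [p e] := @sub_valP _ _ N (x, v) Gxv.
by have := hP p; rewrite /f /g /= e.
Qed.

(** * Vanishing of tensors *)

(** The tensor product of [F] and [N] is modelled by formal sums of elements of [N]
with coefficients in [F], modulo the relations of [N].  Unlike the universal
definition, the model shows what makes a sum of pure tensors vanish. *)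
Section TensorModel.
Variables (R : comNzRingType) (F N : lmodType R).

Definition is_relation (r : seq (R * N)) : Prop := \sum_(p <- r) p.1 *: p.2 = 0.

(** The formal sum obtained from the relation [l.2] of [N] by multiplying its
coefficients by [l.1]. *)
Definition rel_fun (l : F * seq (R * N)) (y : N) : F :=
  \sum_(p <- l.2 | p.2 == y) p.1 *: l.1.

Definition in_relations (c : N -> F) : Prop :=
  exists2 L : seq (F * seq (R * N)), (forall l, l \in L -> is_relation l.2) &
    c = fun y => \sum_(l <- L) rel_fun l y.

Let relations0 : in_relations 0.
Proof. by exists [::] => //; apply/funext => y; rewrite big_nil. Qed.

Let relationsP a c d :
  in_relations c -> in_relations d -> in_relations (a *: c + d).
Proof.
move=> [L Lrel ->] [L' Lrel' ->].
exists ([seq (a *: l.1, l.2) | l <- L] ++ L').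
  by move=> l; rewrite mem_cat => /orP[/mapP[l' /Lrel ? ->]|/Lrel'].
apply/funext => y; rewrite big_cat big_map; congr (_ + _).
rewrite [LHS]scaler_sumr; apply: eq_bigr => l _.
rewrite /rel_fun scaler_sumr; apply: eq_bigr => p _.
by rewrite !scalerA mulrC.
Qed.

Definition relations : submodule (N -> F) := Submodule relations0 relationsP.

Definition model_pure (x : F) (y : N) : quot_mod relations :=
  quot_pi relations (fun z => if y == z then x else 0).

Let model_bilinear :
  bilinear_for (GRing.Scale.Law.clone _ _ ( *:%R ) _)
               (GRing.Scale.Law.clone _ _ ( *:%R ) _) model_pure.
Proof.
split=> [y a x x'|x a y y'] /=; rewrite /model_pure -linearP; apply/quot_pi_eq.
  rewrite (_ : _ - _ = 0); first exact: relations0.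
  apply/eqP; rewrite subr_eq0; apply/eqP/funext => z; rewrite addrfctE scalrfctE.
  by case: eqP; rewrite ?scaler0 ?addr0.
exists [:: (x, [:: (1, a *: y + y'); (- a, y); (-1, y')])].
  move=> l; rewrite inE => /eqP-> /=; rewrite /is_relation !big_cons big_nil /=.
  by rewrite scale1r scaleNr scaleN1r addr0 addrACA !subrr addr0.
apply/funext => z; rewrite big_seq1 /rel_fun !big_cons big_nil /=.
rewrite addrfctE opprfctE addrfctE scalrfctE.
rewrite opprD.
by do 3!case: eqP => _;
  rewrite ?scaler0 ?oppr0 ?addr0 ?add0r ?scale1r ?scaleNr ?scaleN1r
    ?scale1r ?addr0.
Qed.

HB.instance Definition _ := bilinear_isBilinear.Build R F N (quot_mod relations)
  (GRing.Scale.Law.clone _ _ ( *:%R ) _) (GRing.Scale.Law.clone _ _ ( *:%R ) _)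
  model_pure model_bilinear.

Lemma formal_eval_model (s : seq (F * N)) :
  formal_eval model_pure s =
  quot_pi relations (fun y => \sum_(p <- s | p.2 == y) p.1).
Proof.
rewrite /formal_eval -(linear_sum (quot_pi relations)); congr quot_pi.
by apply/funext => y; rewrite fct_sumE [RHS]big_mkcond.
Qed.

End TensorModel.

Lemma tensor_sum (R : comNzRingType) (M N : lmodType R) (x : tensor M N) :
  exists s : seq (M * N), x = \sum_(p <- s) tensor_pure p.1 p.2.
Proof. by exists (repr x); rewrite -tensor_pi_sum reprK. Qed.

Lemma tensor_map_pure (R : comNzRingType) (M M' N : lmodType R)
  (f : {linear M -> M'}) x y :
  tensor_map N f (tensor_pure x y) = tensor_pure (f x) y.
Proof. exact: tensor_lift_pure. Qed.

Lemma sum_by_key (I : Type) (K : eqType) (V : nmodType) (Y : seq K) (s : seq I)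
  (key : I -> K) (F : I -> V) :
  uniq Y -> all (fun p => key p \in Y) s ->
  \sum_(y <- Y) \sum_(p <- s | key p == y) F p = \sum_(p <- s) F p.
Proof.
move=> uY; elim: s => [_|p s IHs /= /andP[pY sY]].
  by rewrite big_nil big1 // => y _; rewrite big_nil.
have pick_key : \sum_(y <- Y) (if key p == y then F p else 0) = F p.
  rewrite (bigD1_seq (key p)) //= eqxx big1 ?addr0 // => y.
  by rewrite eq_sym => /negPf->.
rewrite big_cons -IHs // -[X in X + _]pick_key -big_split.
by apply: eq_bigr => y _ /=; rewrite big_cons; case: eqP; rewrite ?add0r.
Qed.

(** The equational criterion for a tensor to die under [f]: once the terms are
grouped by their second components, their first components become combinations of
elements [u l] of [M'] whose coefficients are relations between those second
components. *)
Lemma tensor_map_eq0 (R : comNzRingType) (M M' N : lmodType R)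
  (f : {linear M -> M'}) (t : tensor M N) : tensor_map N f t = 0 ->
  exists n (x : 'I_n -> M) (y : 'I_n -> N) k (u : 'I_k -> M') (a : 'I_n -> 'I_k -> R),
  [/\ t = \sum_i tensor_pure (x i) (y i),
      forall i, f (x i) = \sum_l a i l *: u l &
      forall l, \sum_i a i l *: y i = 0].
Proof.
have [s ->] := tensor_sum t; rewrite linear_sum => fs0.
have /tensor_piP/(_ _ (@model_pure R M' N)) :
    \pi_(tensor M' N) [seq (f p.1, p.2) | p <- s] = \pi_(tensor M' N) [::].
  rewrite !tensor_pi_sum big_map big_nil -[RHS]fs0.
  by apply: eq_bigr => p _; rewrite /= tensor_map_pure.
rewrite [RHS]/formal_eval big_nil formal_eval_model => /quot_pi0[L Lrel Leq].
pose keys (r : seq (R * N)) := [seq p.2 | p <- r].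
(* The relations in [L] may involve elements of [N] that do not occur in [s]; they
   are keys as well, with coefficient 0 in [t]. *)
pose Y := undup ([seq p.2 | p <- s] ++ flatten [seq keys l.2 | l <- L]).
have uY : uniq Y := undup_uniq _.
have sY : all (fun p => p.2 \in Y) s.
  by apply/allP => p ps; rewrite mem_undup mem_cat (map_f snd ps).
have LY l : l \in L -> all (fun p => p.2 \in Y) l.2.
  move=> lL; apply/allP => p pl; rewrite mem_undup mem_cat; apply/orP; right.
  by apply/flattenP; exists (keys l.2); [apply: map_f|apply: map_f].
pose y (i : 'I_(size Y)) := Y`_i.
pose x (i : 'I_(size Y)) := \sum_(p <- s | p.2 == y i) p.1.
pose L' := in_tuple L.
exists (size Y), x, y, (size L), (fun l => (tnth L' l).1),
  (fun i l => \sum_(p <- (tnth L' l).2 | p.2 == y i) p.1).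
have overY (V : nmodType) (G : N -> V) : \sum_(z <- Y) G z = \sum_i G (y i).
  by rewrite (big_nth 0) big_mkord.
split=> [|i|l].
- rewrite -(overY _ (fun z => tensor_pure (\sum_(p <- s | p.2 == z) p.1) z)).
  rewrite -(sum_by_key _ uY sY); apply: eq_bigr => z _.
  by rewrite linear_sumlz; apply: eq_bigr => p /eqP <-.
- have := congr1 (@^~ (y i)) Leq; rewrite big_map /= -linear_sum => ->.
  rewrite [LHS]big_tnth; apply: eq_bigr => l _.
  by rewrite /rel_fun scaler_suml.
- have lL : tnth L' l \in L := mem_tnth l L'.
  rewrite -[RHS](Lrel _ lL) -(sum_by_key _ uY (LY _ lL)) overY.
  by apply: eq_bigr => i _; rewrite scaler_suml; apply: eq_bigr => p /eqP->.
Qed.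

(** * Exactness of tensor products and flatness *)

Definition surjective_map (A B : Type) (f : A -> B) : Prop :=
  forall y, exists x, f x = y.

Lemma tensor_lift_sum (R : comNzRingType) (M N Q : lmodType R)
  (b : {bilinear M -> N -> Q}) I (r : seq I) (x : I -> M) (y : I -> N) :
  tensor_lift b (\sum_(i <- r) tensor_pure (x i) (y i)) = \sum_(i <- r) b (x i) (y i).
Proof. by rewrite linear_sum; apply: eq_bigr => i _; apply: tensor_lift_pure. Qed.

Lemma tensor_map_sum (R : comNzRingType) (A B N : lmodType R)
  (f : {linear A -> B}) I (r : seq I) (x : I -> A) (y : I -> N) :
  tensor_map N f (\sum_(i <- r) tensor_pure (x i) (y i)) =
  \sum_(i <- r) tensor_pure (f (x i)) (y i).
Proof. by rewrite linear_sum; apply: eq_bigr => i _; apply: tensor_map_pure. Qed.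

Lemma tensor_map_comp (R : comNzRingType) (A B C N : lmodType R)
  (f : {linear A -> B}) (g : {linear B -> C}) t :
  tensor_map N (g \o f) t = tensor_map N g (tensor_map N f t).
Proof.
have [s ->] := tensor_sum t; by rewrite !tensor_map_sum.
Qed.

Lemma tensor_map_surj (R : comNzRingType) (A B N : lmodType R)
  (f : {linear A -> B}) : surjective_map f -> surjective_map (tensor_map N f).
Proof.
move=> fS t; have [s ->] := tensor_sum t; elim: s => [|p s [x ex]].
  by exists 0; rewrite raddf0 big_nil.
have [y ey] := fS p.1; exists (tensor_pure y p.2 + x).
by rewrite big_cons linearD -ex -ey -tensor_map_pure.
Qed.

Lemma tensor_map_complex (R : comNzRingType) (A B C N : lmodType R)
  (f : {linear A -> B}) (g : {linear B -> C}) t :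
  (forall x, g (f x) = 0) -> tensor_map N g (tensor_map N f t) = 0.
Proof.
move=> gf0; have [s ->] := tensor_sum t; rewrite !tensor_map_sum big1 // => p _.
by rewrite gf0 linear0l.
Qed.

(** If x_i maps to a combination of the u_l, subtracting a lift of it from x_i
leaves an element of the image of [f], and the lifts contribute
v_l tensor (a relation of the y_i), which is zero. *)
Lemma tensor_right_exact (R : comNzRingType) (A B C N : lmodType R)
  (f : {linear A -> B}) (g : {linear B -> C}) :
  exact_at f g -> surjective_map g -> exact_at (tensor_map N f) (tensor_map N g).
Proof.
move=> fg gS t; split=> [|[s <-]]; last first.
  by apply: tensor_map_complex => x; apply/fg; exists x.
move=> /tensor_map_eq0[n [x [y [k [u [a [-> xu ay]]]]]]].
have [v vP] := choice (fun l => gS (u l)).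
have /choice[z zP] i : exists z, f z = x i - \sum_l a i l *: v l.
  apply/fg; rewrite linearB xu linear_sum /=; apply/eqP; rewrite subr_eq0; apply/eqP.
  by apply: eq_bigr => l _; rewrite linearZ /= vP.
exists (\sum_i tensor_pure (z i) (y i)).
rewrite tensor_map_sum; under eq_bigr => i _ do rewrite zP linearBl /=.
rewrite sumrB [X in _ - X](_ : _ = 0) ?subr0 //.
under eq_bigr => i _ do rewrite linear_sumlz.
rewrite exchange_big big1 // => l _ /=.
under eq_bigr => i _ do rewrite linearZl_LR -linearZr_LR.
by rewrite -linear_sumr ay linear0r.
Qed.

(** Every finite system of linear equations satisfied in [F] is explained by
solutions in [R].  Treating several equations at once avoids an induction in
[equationally_flatP]. *)
Definition equationally_flat (R : comNzRingType) (F : lmodType R) : Prop :=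
  forall n k (y : 'I_n -> F) (a : 'I_n -> 'I_k -> R),
    (forall l, \sum_i a i l *: y i = 0) ->
    exists m (w : 'I_m -> F) (b : 'I_n -> 'I_m -> R),
      (forall i, y i = \sum_j b i j *: w j) /\
      forall l j, \sum_i a i l * b i j = 0.

Lemma equationally_flatP (R : comNzRingType) (F : lmodType R) :
  equationally_flat F -> flat F.
Proof.
move=> Feq A B C f g fg t; split=> [|[s <-]]; last first.
  by apply: tensor_map_complex => x; apply/fg; exists x.
move=> /tensor_map_eq0[n [x [y [k [u [a [-> xu ay]]]]]]].
have [m [w [b [yw ab]]]] := Feq _ _ _ _ ay.
have /choice[z zP] j : exists z, f z = \sum_i b i j *: x i.
  apply/fg; rewrite linear_sum.
  under eq_bigr => i _ do rewrite linearZ /= xu scaler_sumr.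
  rewrite exchange_big big1 // => l _; rewrite /=.
  under eq_bigr => i _ do rewrite scalerA mulrC.
  by rewrite -scaler_suml ab scale0r.
exists (\sum_j tensor_pure (z j) (w j)).
rewrite tensor_map_sum; under eq_bigr => j _ do rewrite zP linear_sumlz.
rewrite exchange_big; apply: eq_bigr => i _ /=.
rewrite [in RHS]yw linear_sumr; apply: eq_bigr => j _.
by rewrite linearZl_LR linearZr_LR.
Qed.

(** The scalar action as a bilinear map out of [R^o * F]; it detects that a pure
tensor [1 (x) x] is nonzero. *)
Section ScalePairing.
Variables (R : comNzRingType) (F : lmodType R).
Definition scale_pair (r : R^o) (x : F) : F := (r : R) *: x.
Let scale_pair_bilinear :
  bilinear_for (GRing.Scale.Law.clone _ _ ( *:%R ) _)
               (GRing.Scale.Law.clone _ _ ( *:%R ) _) scale_pair.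
Proof.
split=> [x a r s|r a x y] /=; rewrite /scale_pair.
  by rewrite [X in X *: _ = _]/(_ + _) scalerDl scalerA.
by rewrite scalerDr !scalerA mulrC.
Qed.
HB.instance Definition _ := bilinear_isBilinear.Build R R^o F F
  (GRing.Scale.Law.clone _ _ ( *:%R ) _) (GRing.Scale.Law.clone _ _ ( *:%R ) _)
  scale_pair scale_pair_bilinear.
End ScalePairing.

(** Multiplication by [c] is injective on [R^o], hence remains so after tensoring
with [F]. *)
Lemma flat_regular (R : comNzRingType) (F : lmodType R) (c : R) :
  flat F -> (forall r, c * r = 0 -> r = 0) ->
  forall x : F, c *: x = 0 -> x = 0.
Proof.
move=> Fflat c_reg x cx0.
pose mulc : {linear R^o -> R^o} := *:%R c.
have mulc_exact : exact_at (\0 : {linear R^o -> R^o}) mulc.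
  move=> r; split=> [/c_reg->|[y <-]]; first by exists 0.
  by rewrite raddf0.
have [+ _] := Fflat _ _ _ _ _ mulc_exact (tensor_pure (1 : R^o) x).
rewrite tensor_map_pure /mulc linearZl_LR -linearZr_LR cx0 linear0r.
case=> // t et.
have := congr1 (tensor_lift (@scale_pair R F)) et.
rewrite tensor_lift_pure [RHS](scale1r x) => <-.
have [s ->] := tensor_sum t; rewrite tensor_map_sum tensor_lift_sum big1 // => p _.
exact: scale0r.
Qed.

Lemma exact_splice (R : comNzRingType) (A K B C D : lmodType R)
  (p : {linear A -> K}) (i : {linear K -> B}) (q : {linear B -> C})
  (j : {linear C -> D}) :
  surjective_map p -> exact_at i q -> injective j ->
  exact_at (i \o p) (j \o q).
Proof.
move=> pS iq j_inj y; split=> /=.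
  rewrite -[X in _ = X](raddf0 j) => /j_inj/iq[k <-].
  by have [x <-] := pS k; exists x.
by move=> [x <-]; rewrite (_ : q _ = 0) ?raddf0 //; apply/iq; exists (p x).
Qed.

(** * Local quasi-Frobenius rings *)

Lemma mem_ideal_gen (R : comNzRingType) (s : seq R) x :
  x \in s -> x \in ideal_gen s.
Proof.
move=> /(nthP 0)[i ltis <-]; apply/asboolP.
exists (fun j => (j == Ordinal ltis)%:R).
rewrite (bigD1 (Ordinal ltis)) //= eqxx mul1r big1 ?addr0 //.
by move=> j /negPf->; rewrite mul0r.
Qed.

(** Induction on [n]: generators for the ideal of first coordinates, together with
generators for the vectors whose first coordinate is zero. *)
Lemma noetherian_free_module (R : comNzRingType) : noetherian R ->
  forall n (N : submodule 'rV[R]_n), exists r (G : 'M[R]_(r, n)),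
    (forall i, N (row i G)) /\ forall v, N v -> exists c : 'rV_r, v = c *m G.
Proof.
move=> Rnoeth; elim=> [N|n IHn].
  exists 0%N, 0; split=> [[]//|v _]; exists 0.
  by apply/rowP=> -[].
rewrite -[n.+1]add1n => N.
pose I : {pred R} := fun x => `[< exists v : 'rV[R]_n, N (row_mx x%:M v) >].
have I_ideal : is_ideal I.
  split; first by apply/asboolP; exists 0; rewrite raddf0 row_mx0; apply: in_sub0.
  move=> a x y /asboolP[v Nv] /asboolP[w Nw]; apply/asboolP; exists (a *: v + w).
  have := in_subP a Nv Nw; congr (N _).
  by rewrite scale_row_mx add_row_mx scale_scalar_mx -raddfD.
have [s Is] := Rnoeth _ I_ideal.
have /choice[g gP] (i : 'I_(size s)) : exists v : 'rV[R]_n, N (row_mx (s`_i)%:M v).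
  apply/asboolP; rewrite -[`[< _ >]]/(s`_i \in I) Is.
  by apply/mem_ideal_gen/mem_nth.
have N'P a (v w : 'rV[R]_n) : N (row_mx 0 v) -> N (row_mx 0 w) ->
    N (row_mx 0 (a *: v + w)).
  by move=> Nv Nw; have := in_subP a Nv Nw;
    rewrite scale_row_mx add_row_mx scaler0 addr0.
have N'0 : N (row_mx 0 (0 : 'rV[R]_n)) by rewrite row_mx0; apply: in_sub0.
have [r [G [NG GN]]] := IHn (Submodule N'0 N'P).
pose H : 'M[R]_(size s, 1 + n) := \matrix_i row_mx (s`_i)%:M (g i).
exists (size s + r)%N, (col_mx H (row_mx 0 G)); split=> [i|w Nw].
  case: (split_ordP i) => j ->; rewrite ?rowKu ?rowKd ?rowK //.
  by rewrite row_row_mx row0; apply: NG.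
have : lsubmx w 0 0 \in I.
  apply/asboolP; exists (rsubmx w).
  by rewrite -mx11_scalar hsubmxK.
rewrite Is => /asboolP[c wc].
pose C := \row_i c i.
have wL : lsubmx (w - C *m H) = 0.
  apply/rowP => j; rewrite [j]ord1 linearB [LHS]mxE wc !mxE; apply/eqP.
  rewrite subr_eq0; apply/eqP/eq_bigr => i _.
  by rewrite [C _ _]mxE [H _ _]mxE row_mxEl mxE eqxx mulr1n.
have [c' cG'] : exists c', rsubmx (w - C *m H) = c' *m G.
  apply: GN => /=; rewrite -wL hsubmxK.
  apply: in_subB => //; rewrite mulmx_sum_row; apply: in_sub_sum => i _.
  by apply: in_subZ; rewrite rowK; apply: gP.
exists (row_mx C c'); rewrite mul_row_col mul_mx_row mulmx0 -cG' -wL hsubmxK.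
by rewrite addrC subrK.
Qed.

Section LocalQF.
Variables (R : comNzRingType) (m : {pred R}).
Hypotheses (R_local : local_ring m) (R_QF : quasi_Frobenius R).

Lemma local_ideal : idealr_closed m.
Proof. by case: R_local => -[]. Qed.

(** A nonunit lies in a maximal ideal by Zorn's lemma, and [m] is the only one.
The ordering is on sets [A] such that [A] together with the multiples of [a] is a
proper ideal, which lets the empty chain be bounded as well. *)
Lemma local_nonunit a : (forall b, b * a != 1) -> a \in m.
Proof.
move=> a_nu; pose J (A : set R) : {pred R} := fun x => `[< A x \/ exists b, x = b * a >].
have [F FP Ftot|A [JA Amax]] := @Zorn_bigcup R (fun A => idealr_closed (J A)).
  split.
  - by apply/asboolP; right; exists 0; rewrite mul0r.
  - apply/negP => /asboolP[[A FA A1]|[b /esym/eqP]]; last exact/negP.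
    by have [_ /negP[]] := FP _ FA; apply/asboolP; left.
  move=> c x y /asboolP xJ /asboolP yJ; apply/asboolP.
  have inA A : F A -> x \in J A -> y \in J A ->
    (\bigcup_(X in F) X)%classic (c * x + y) \/ exists b, c * x + y = b * a.
    move=> FA xA yA; have [_ _ /(_ c _ _ xA yA)/asboolP[?|?]] := FP _ FA; last by right.
    by left; exists A.
  case: xJ => [[A FA Ax]|[b xb]]; case: yJ => [[B FB By]|[b' yb]].
  - by have [AB|BA] := Ftot _ _ FA FB; [apply: (inA B)|apply: (inA A)] => //;
      apply/asboolP; left => //; [apply: AB|apply: BA].
  - by apply: (inA A) => //; apply/asboolP; [left|right; exists b'].
  - by apply: (inA B) => //; apply/asboolP; [right; exists b|left].
  - by right; exists (c * b + b'); rewrite xb yb mulrDl mulrA.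
have Jmax : maximal_ideal (J A).
  split=> // K K_id JK x; apply/idP/idP => [xK|]; last exact: JK.
  apply: contrapT => xJ; apply: (Amax (fun x => x \in K)).
    split=> [z Az|KA]; first by apply: JK; apply/asboolP; left.
    by apply: xJ; apply/asboolP; left; apply: KA.
  rewrite (_ : J _ = K) //; apply/funext => z; apply/asboolP/idP => [[//|[b ->]]|zK].
    by apply: JK; apply/asboolP; right; exists b.
  by left.
have [_ /(_ _ Jmax) <-] := R_local; apply/asboolP; right; exists 1.
by rewrite mul1r.
Qed.

Lemma local_unit a : a \notin m -> exists b, b * a = 1.
Proof.
move=> am; apply: contrapT => ab; move: am; rewrite local_nonunit // => b.
by apply/eqP => e; apply: ab; exists b.
Qed.

Lemma local_is_ideal : is_ideal m.
Proof. by have [] := local_ideal. Qed.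

(** The annihilators of the powers of [y] stabilise at some [K], so that
[y ^+ K.+1 |-> y ^+ K] is a well defined linear map on a principal ideal.  By
self-injectivity it is multiplication by some [c], whence [(1 - y * c) * y ^+ K = 0]
where the first factor is a unit. *)
Lemma maximal_nilpotent y : y \in m -> exists k, y ^+ k = 0.
Proof.
move=> ym; have [Rnoeth Rinj] := R_QF.
pose I : {pred R} := fun x => `[< exists k, x * y ^+ k = 0 >].
have I_ideal : is_ideal I.
  split; first by apply/asboolP; exists 0%N; rewrite mul0r.
  move=> a x z /asboolP[k xk] /asboolP[l zl]; apply/asboolP; exists (k + l)%N.
  rewrite mulrDl exprD -[a *: x]/(a * x) -[a * x * _]mulrA [x * _]mulrA xk mul0r mulr0.
  by rewrite add0r [y ^+ k * _]mulrC mulrA zl mul0r.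
have [s Is] := Rnoeth _ I_ideal.
have /choice[k kP] (i : 'I_(size s)) : exists k, s`_i * y ^+ k = 0.
  apply/asboolP; rewrite -[`[< _ >]]/(s`_i \in I) Is.
  by apply/mem_ideal_gen/mem_nth.
pose K := (\sum_i k i)%N.
have stab r : r * y ^+ K.+1 = 0 -> r * y ^+ K = 0.
  move=> rK; have : r \in I by apply/asboolP; exists K.+1.
  rewrite Is => /asboolP[c ->]; rewrite mulr_suml big1 // => i _.
  by rewrite -mulrA /K (bigD1 i) //= exprD [s`_i * _]mulrA kP mul0r mulr0.
have [||v [r [r0 ->]]|h hP] :=
  @injective_graph R R^o R^o (fun z v => exists r, z = r * y ^+ K.+1 /\ v = r * y ^+ K) Rinj.
- by exists 0; rewrite !mul0r.
- move=> a x z v w [r [-> ->]] [t [-> ->]]; exists (a * r + t).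
  by rewrite !mulrDl -!mulrA.
- by apply: stab.
have hK : y ^+ K.+1 * h 1 = y ^+ K.
  have <- : h (y ^+ K.+1 *: (1 : R^o)) = y ^+ K.+1 * h 1 by apply: linearZ_LR.
  rewrite [_ *: _]mulr1; apply: hP.
  by exists 1; rewrite !mul1r.
exists K; have [|b b1] := @local_unit (1 - y * h 1).
  apply/negP => m1; have [_ /negP m1n mP] := local_ideal; apply: m1n.
  by have := mP (h 1) _ _ ym m1; rewrite [h 1 * y]mulrC addrC subrK.
by rewrite -[LHS]mul1r -b1 -mulrA mulrBl mul1r mulrAC -exprS hK subrr mulr0.
Qed.

(** Starting from 1, multiply in turn by the highest power of each generator of
[m] that does not annihilate the current element. *)
Lemma socle_neq0 : exists2 u : R, u != 0 & forall x, x \in m -> x * u = 0.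
Proof.
have [Rnoeth _] := R_QF; have [s ms] := Rnoeth _ local_is_ideal.
suff [u u0 uP] : exists2 u : R, u != 0 & forall x, x \in s -> x * u = 0.
  exists u => // x; rewrite ms => /asboolP[c ->]; rewrite mulr_suml big1 // => i _.
  by rewrite -mulrA uP ?mulr0 // mem_nth.
have : {subset s <= m} by move=> x xs; rewrite ms; apply: mem_ideal_gen.
elim: s {ms} => [|y s IHs] sm; first by exists 1; rewrite ?oner_neq0.
have [x xs|u u0 uP] := IHs; first by apply: sm; rewrite inE xs orbT.
have [k yk] := maximal_nilpotent (sm y (mem_head _ _)).
have exk : exists k, y ^+ k * u == 0 by exists k; rewrite yk mul0r.
case: (ex_minnP exk) => -[|l]; first by rewrite mul1r (negPf u0).
rewrite exprS -mulrA => /eqP yl lmin.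
exists (y ^+ l * u); first by apply/negP => /lmin; rewrite ltnn.
by move=> x; rewrite inE => /predU1P[->//|xs]; rewrite mulrCA uP ?mulr0.
Qed.

(** Modulo [N] the vector [v] has a proper annihilator, contained in [m], so that
[v] can be sent to an element of the socle; the map extends by self-injectivity. *)
Lemma cogenerator (V : lmodType R) (N : submodule V) v : ~ N v ->
  exists phi : {linear V -> R^o}, (forall x, N x -> phi x = 0) /\ phi v != 0.
Proof.
move=> Nv; have [u u0 uP] := socle_neq0; have [_ Rinj] := R_QF.
have [||w [r [n [Nn [r0 ->]]]]|h hP] := @injective_graph R R^o V
  (fun z w => exists r n, N n /\ (z = r *: v + n /\ w = r * u)) Rinj.
- by exists 0, 0; rewrite scale0r mul0r addr0; split=> //; apply: in_sub0.
- move=> a x y w w' [r [n [Nn [-> ->]]]] [t [n' [Nn' [-> ->]]]].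
  exists (a * r + t), (a *: n + n'); split; first exact: in_subP.
  by split; rewrite ?mulrDl -?mulrA // scalerDr scalerDl !scalerA addrACA.
- apply: uP; apply: local_nonunit => b; apply/eqP => br1; apply: Nv.
  rewrite -[v]scale1r -br1 -scalerA; apply: in_subZ.
  by rewrite -[_ *: v](addrK n) -r0 sub0r; apply: in_subN.
exists h; split=> [x Nx|].
  by apply: hP; exists 0, x; rewrite scale0r add0r mul0r.
rewrite (hP v u) //; exists 1, 0; rewrite scale1r addr0 mul1r.
by split=> //; apply: in_sub0.
Qed.

End LocalQF.

(** * Modules over the power series ring *)

Section PowerSeries.
Variable R : comNzRingType.
Local Notation S := (powser R).
Implicit Types f g : S.

Definition psX : S := fun n => (n == 1%N)%:R.
Definition psC (r : R) : S := fun n => if n is 0%N then r else 0.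
Definition ps0 f : R := f 0%N.
Definition shift f : S := fun n => f n.+1.

Lemma psD f g n : (f + g) n = f n + g n.
Proof. by []. Qed.

Lemma psM f g n : (f * g) n = \sum_(i < n.+1) f i * g (n - i)%N.
Proof. by []. Qed.

Lemma psM0 f g : (f * g) 0%N = f 0%N * g 0%N.
Proof. by rewrite psM big_ord1. Qed.

Lemma psCM r f n : (psC r * f) n = r * f n.
Proof. by rewrite psM big_ord_recl big1 ?addr0 ?subn0 // => i _; rewrite mul0r. Qed.

Lemma psXM0 f : (psX * f) 0%N = 0.
Proof. by rewrite psM0 mul0r. Qed.

Lemma psXMS f n : (psX * f) n.+1 = f n.
Proof.
rewrite psM !big_ord_recl mul0r add0r mul1r big1 ?addr0 ?subSS ?subn0 //.
by move=> i _; rewrite mul0r.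
Qed.

Lemma psXI f : psX * f = 0 -> f = 0.
Proof. by move=> e; apply/funext => n; rewrite -psXMS e. Qed.

Lemma ps_split f : f = psC (f 0%N) + psX * shift f.
Proof.
by apply/funext => -[|n]; rewrite psD ?psXM0 ?psXMS ?addr0 ?add0r.
Qed.

Let ps0_zmod : zmod_morphism ps0. Proof. by []. Qed.
HB.instance Definition _ := GRing.isZmodMorphism.Build S R ps0 ps0_zmod.
Let ps0_monoid : monoid_morphism ps0.
Proof. by split=> // f g; apply: psM0. Qed.
HB.instance Definition _ := GRing.isMonoidMorphism.Build S R ps0 ps0_monoid.

Let psC_zmod : zmod_morphism psC.
Proof. by move=> r s; apply/funext => -[|n] //; rewrite [RHS]subr0. Qed.
HB.instance Definition _ := GRing.isZmodMorphism.Build R S psC psC_zmod.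
Let psC_monoid : monoid_morphism psC.
Proof.
split; first by apply/funext => -[].
by move=> r s; apply/funext => n; rewrite psCM; case: n => //= n; rewrite mulr0.
Qed.
HB.instance Definition _ := GRing.isMonoidMorphism.Build R S psC psC_monoid.

Definition X_regular (M : lmodType S) : Prop := forall x : M, psX *: x = 0 -> x = 0.

Lemma X_regularP (M : lmodType S) : X_regular M -> injective ( *:%R psX : M -> M).
Proof.
move=> Mtf x y e; apply/eqP; rewrite -subr_eq0; apply/eqP/Mtf.
by rewrite scalerBr e subrr.
Qed.

Lemma sub_mod_regular (M : lmodType S) (N : submodule M) :
  X_regular M -> X_regular (sub_mod N).
Proof.
move=> Mreg x x0; apply: sub_val_inj; rewrite raddf0; apply: Mreg.
by rewrite -sub_valZ x0 raddf0.
Qed.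

Lemma flat_X_regular (F : lmodType S) : flat F -> X_regular F.
Proof. by move=> Fflat; apply: flat_regular => //; apply: psXI. Qed.

(** Restriction of scalars along [psC], on a copy of the carrier so that the two
module structures do not compete. *)
Section Restriction.
Variable M : lmodType S.
Definition restrict : Type := M.
HB.instance Definition _ := GRing.Zmodule.on restrict.
Definition restrict_scale (r : R) (x : restrict) : restrict := psC r *: (x : M).
Let scaleA a b x : restrict_scale a (restrict_scale b x) = restrict_scale (a * b) x.
Proof. by rewrite /restrict_scale scalerA rmorphM. Qed.
Let scale1 : left_id 1 restrict_scale.
Proof. by move=> x; rewrite /restrict_scale rmorph1 scale1r. Qed.
Let scaleDr : right_distributive restrict_scale +%R.
Proof. by move=> a x y; apply: scalerDr. Qed.
Let scaleDl x : {morph restrict_scale^~ x : a b / a + b}.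
Proof. by move=> a b; rewrite /restrict_scale rmorphD; apply: scalerDl. Qed.
HB.instance Definition _ := GRing.Zmodule_isLmodule.Build R restrict
  scaleA scale1 scaleDr scaleDl.
End Restriction.

(** [H] is the graph of an S-linear map from a submodule A of [B] to S, and [Hsat]
says that A is X-saturated. *)
Section Extension.
Hypothesis Rinj : injective_module (R^o : lmodType R).
Variables (B : lmodType S) (H : B -> S -> Prop).
Hypotheses (H0 : H 0 0)
  (HP : forall a x y f g, H x f -> H y g -> H (a *: x + y) (a * f + g))
  (Hfun : forall f, H 0 f -> f = 0)
  (Hsat : forall b f, H (psX *: b) f -> exists g, H b g).

Let H_sub x y f g : H x f -> H y g -> H (x - y) (f - g).
Proof. by move=> Hx Hy; have := HP (-1) Hy Hx; rewrite scaleN1r mulN1r ![- _ + _]addrC. Qed.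
Let H_functional x f g : H x f -> H x g -> f = g.
Proof.
move=> Hf Hg; apply/eqP; rewrite -subr_eq0; apply/eqP/Hfun.
by rewrite -[X in H X](subrr x); apply: H_sub.
Qed.

(** One coefficient of the extension, [p] being the previous one.  The value on
[a + psX *: b] is forced.  If this sum vanishes then [psX *: b] lies in the domain
of [H], hence so does [b] by saturation, and there [p] is known. *)
Lemma extend_coef n (p : {linear restrict B -> R^o}) :
  (forall b f, H b f -> p b = (psX * f) n) ->
  exists q : {linear restrict B -> R^o},
    (forall b f, H b f -> q b = f n) /\ forall b : B, q (psX *: b) = p b.
Proof.
move=> pP.
have [||v [a [b [f [Hf [ab ->]]]]]|q qP] := @injective_graph R R^o (restrict B)
  (fun z v => exists (a b : B) (f : S), H a f /\ z = a + psX *: b /\ v = f n + p b) Rinj.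
- by exists 0, 0, 0; rewrite scaler0 addr0 (raddf0 p) addr0.
- move=> r x y v w [a [b [f [Hf [-> ->]]]]] [a' [b' [f' [Hf' [-> ->]]]]].
  exists (psC r *: a + a'), (psC r *: b + b'), (psC r * f + f').
  split; first exact: HP.
  split.
    rewrite -[r *: _]/(psC r *: (a + psX *: b)) !scalerDr !scalerA.
    by rewrite [psX * _]mulrC addrACA.
  have -> : p (psC r *: b + b') = r * p b + p b' by apply: (linearP p).
  rewrite psD psCM -[r *: _]/(r * (f n + p b)).
  by rewrite mulrDr addrACA.
- have ebN : a = psX *: (- b).
    by apply/eqP; rewrite scalerN -subr_eq0 opprK -ab.
  rewrite ebN in Hf; have [g Hg] := Hsat Hf.
  have fg : f = psX * g.
    apply: H_functional Hf _; rewrite -[psX *: _]addr0 -[psX * g]addr0.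
    exact: HP.
  have := pP _ _ Hg; rewrite -fg => <-.
  by rewrite -raddfD addNr raddf0.
exists q; split=> [b f Hf|b].
  by apply: qP; exists b, 0, f; rewrite scaler0 addr0 (raddf0 p) addr0.
by apply: qP; exists 0, b, 0; rewrite !add0r.
Qed.

Let extend_next n (p : {linear restrict B -> R^o}) :
  exists q : {linear restrict B -> R^o}, (forall b f, H b f -> p b = f n) ->
    (forall b f, H b f -> q b = f n.+1) /\ forall b : B, q (psX *: b) = p b.
Proof.
have [pP|npP] := pselect (forall b f, H b f -> p b = f n); last by exists p => /npP.
have [|q qP] := @extend_coef n.+1 p; last by exists q.
by move=> b f Hf; rewrite psXMS; apply: pP.
Qed.

(** The coefficient of degree 0 is left to the caller: for [functionals_detect] it
is the one that separates points. *)
Lemma extend_linear (p : {linear restrict B -> R^o}) :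
  (forall b f, H b f -> p b = f 0%N) -> (forall b : B, p (psX *: b) = 0) ->
  exists phi : {linear B -> S^o},
    (forall b f, H b f -> phi b = f) /\ forall b, (phi b : S) 0%N = p b.
Proof.
move=> p0 pX.
have [F FP] := @choice (nat * {linear restrict B -> R^o}) {linear restrict B -> R^o}
  (fun np q => (forall b f, H b f -> np.2 b = f np.1) ->
    (forall b f, H b f -> q b = f np.1.+1) /\ forall b : B, q (psX *: b) = np.2 b)
  (fun '(n, q) => extend_next n q).
pose coef := fix coef n := if n is k.+1 then F (k, coef k) else p.
have coefP n b f : H b f -> coef n b = f n.
  elim: n b f => [|n IHn] b f; first exact: p0.
  by have [+ _] := FP (n, coef n) IHn; apply.
have coefX n (b : B) : coef n.+1 (psX *: b) = coef n b.
  by have [_ +] := FP (n, coef n) (coefP n); apply.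
pose phi (b : B) : S^o := (fun n => coef n b) : S.
have phiD : {morph phi : x y / x + y}.
  by move=> x y; apply/funext => n; apply: (raddfD (coef n)).
have phiC r b : phi (psC r *: b) = psC r * (phi b : S).
  apply/funext => n; rewrite psCM.
  by rewrite -[LHS]/(coef n (r *: (b : restrict B))) linearZ.
have phiX b : phi (psX *: b) = psX * (phi b : S).
  by apply/funext => -[|n]; rewrite ?psXM0 ?psXMS; [apply: pX|apply: coefX].
have phiZ a b : phi (a *: b) = a * (phi b : S).
  apply/funext => n; elim: n a b => [|n IHn] a b;
    rewrite [in LHS](ps_split a) [in RHS](ps_split a) scalerDl -scalerA phiD phiC phiX mulrDl.
    by rewrite !psD -mulrA !psXM0.
  by rewrite !psD -mulrA !psXMS IHn.
have phi_lin : linear phi by move=> a x y; rewrite phiD phiZ.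
pose mor := GRing.isLinear.Build S B S^o _ phi phi_lin.
pose Phi : {linear B -> S^o} := HB.pack phi mor.
exists Phi; split=> // b f Hf; apply/funext => n; exact: coefP.
Qed.

End Extension.

Definition X_saturated (V : lmodType S) (N : submodule V) :=
  forall v, N (psX *: v) -> N v.

Lemma X_divides m n (v : 'M[S]_(m, n)) :
  map_mx ps0 v = 0 -> v = psX *: map_mx shift v.
Proof.
move=> v0; apply/matrixP => i j; rewrite 2!mxE [LHS]ps_split.
have := congr1 (fun w : 'M_(m, n) => w i j) v0; rewrite !mxE /ps0 => ->.
by rewrite raddf0 add0r.
Qed.

(** The matrix [D 0] is divisible by all powers of X. *)
Lemma X_separated m n (D : nat -> 'M[S]_(m, n)) :
  (forall k, D k = psX *: D k.+1) -> D 0%N = 0.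
Proof.
move=> DX; apply/matrixP => i j; rewrite mxE; apply/funext => k.
suff: forall l, D l i j k = 0 by [].
by elim: k => [|k IHk] l; rewrite DX mxE ?psXM0 ?psXMS.
Qed.

Hypothesis Rnoeth : noetherian R.

(** Reduce modulo X and lift generators of the reduction; since [N] is saturated,
what remains after subtracting a combination of the lifts is X times an element of
[N], and the coefficients of successive remainders assemble into power series.  The
generators can be taken in any [N0] with the same reduction as [N]; then [N] turns
out to be contained in [N0], and [krull] rests on this. *)
Lemma saturated_fg n (N N0 : submodule 'rV[S]_n) : X_saturated N ->
  (forall v, N0 v -> N v) ->
  (forall v, N v -> exists v0 w, N0 v0 /\ v = v0 + psX *: w) ->
  exists r (g : 'M[S]_(r, n)),
    (forall i, N0 (row i g)) /\ forall v, N v -> exists c : 'rV_r, v = c *m g.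
Proof.
move=> Nsat N0N NX.
pose inN v := exists2 w, N0 w & map_mx ps0 w = v.
have inN0 : inN 0 by exists 0; [apply: in_sub0|rewrite raddf0].
have inNP a v w : inN v -> inN w -> inN (a *: v + w).
  move=> [x Nx <-] [y Ny <-]; exists (psC a *: x + y); first exact: in_subP.
  by rewrite map_mxD map_mxZ.
have [r [G [NG GN]]] := noetherian_free_module Rnoeth (Submodule inN0 inNP).
have /choice[gi giP] i : exists w, N0 w /\ map_mx ps0 w = row i G.
  by have [w] := NG i; exists w.
pose g := \matrix_i gi i.
have gN0 i : N0 (row i g) by rewrite rowK; case: (giP i).
have g0 : map_mx ps0 g = G.
  by apply/row_matrixP => i; rewrite -map_row rowK; case: (giP i).
exists r, g; split=> // v Nv.
have step w : exists cw : 'rV[R]_r * 'rV[S]_n,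
    N w -> N cw.2 /\ w = map_mx psC cw.1 *m g + psX *: cw.2.
  have [Nw|nNw] := pselect (N w); last by exists (0, 0) => /nNw.
  have [w0 [w1 [N0w0 ew]]] := NX _ Nw.
  have [|c cP] := GN (map_mx ps0 w); first exists w0 => //.
    rewrite ew map_mxD map_mxZ /= [ps0 psX](_ : _ = 0) ?scale0r ?addr0 //.
  pose d := w - map_mx psC c *m g.
  have dX : d = psX *: map_mx shift d.
    apply: X_divides; rewrite map_mxB map_mxM g0 -map_mx_comp.
    by rewrite cP (_ : map_mx _ c = c) ?subrr //; apply/matrixP => i j; rewrite mxE.
  exists (c, map_mx shift d) => _ /=; rewrite -dX addrC subrK; split=> //.
  apply: Nsat; rewrite -dX; apply: in_subB => //; rewrite mulmx_sum_row.
  by apply: in_sub_sum => i _; apply/in_subZ/N0N.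
have [F FP] := choice step.
pose v_ k := iter k (fun w => (F w).2) v.
have Nv_ k : N (v_ k) by elim: k => //= k /FP[].
pose C k : 'rV[S]_r := \row_i ((fun j => (F (v_ (k + j)%N)).1 0 i) : S).
have CS k : C k = map_mx psC (F (v_ k)).1 + psX *: C k.+1.
  apply/rowP => i; rewrite !mxE [LHS]ps_split /= addn0; congr (_ + _ * _).
  by apply/funext => j; rewrite /shift addnS.
exists (C 0%N); apply/eqP; rewrite -subr_eq0; apply/eqP.
apply: (@X_separated _ _ (fun k => v_ k - C k *m g)) => k.
have [_ {1}->] := FP _ (Nv_ k).
by rewrite CS mulmxDl opprD addrACA subrr add0r -scalemxAl scalerBr.
Qed.

Corollary saturated_generators n (N : submodule 'rV[S]_n) : X_saturated N ->
  exists r (g : 'M[S]_(r, n)),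
    (forall i, N (row i g)) /\ forall v, N v -> exists c : 'rV_r, v = c *m g.
Proof.
move=> Nsat; apply: saturated_fg => // v Nv.
by exists v, 0; split; rewrite ?scaler0 ?addr0.
Qed.

Lemma syzygies_fg n k (a : 'M[S]_(n, k)) :
  exists r (g : 'M[S]_(r, n)), g *m a = 0 /\
    forall v : 'rV_n, v *m a = 0 -> exists c : 'rV_r, v = c *m g.
Proof.
pose N := kernel (mulmxr a : {linear 'rV[S]_n -> 'rV[S]_k}).
have Nsat : X_saturated N.
  move=> v /= Nv; apply/rowP => j; rewrite [RHS]mxE; apply: psXI.
  by have := congr1 (fun w : 'rV_k => w 0 j) Nv; rewrite -scalemxAl !mxE.
have [r [g [gN Ng]]] := saturated_generators Nsat.
exists r, g; split=> //; apply/row_matrixP => i.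
by rewrite row_mul row0; apply: gN.
Qed.

Section Span.
Variables (M : lmodType S) (n : nat) (e : 'I_n -> M).

Definition comb (v : 'rV[S]_n) : M := \sum_i v 0 i *: e i.
Let comb_linear : linear comb.
Proof.
move=> a v w; rewrite /comb scaler_sumr -big_split; apply: eq_bigr => i _.
by rewrite !mxE scalerDl scalerA.
Qed.
HB.instance Definition _ := GRing.isLinear.Build S 'rV[S]_n M _ comb comb_linear.

(** The coordinates of the infinitely divisible elements form a saturated module,
which agrees modulo X with the module of relations between the [e i]. *)
Lemma krull v : X_regular M ->
  (forall k, exists w, comb v = psX ^+ k *: comb w) -> comb v = 0.
Proof.
move=> Mtf vP; pose P v := forall k, exists w, comb v = psX ^+ k *: comb w.
have P0 : P 0 by move=> k; exists 0; rewrite raddf0 scaler0.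
have PP a x y : P x -> P y -> P (a *: x + y).
  move=> Px Py k; have [x' ex] := Px k; have [y' ey] := Py k.
  by exists (a *: x' + y'); rewrite !linearP /= ex ey.
pose N := Submodule P0 PP.
have Nsat : X_saturated N.
  move=> w Nw k; have [x ex] := Nw k.+1; exists x; apply: (X_regularP Mtf).
  by rewrite /= scalerA -exprS -ex linearZ.
have [||r [g [gN Ng]]] := saturated_fg (N0 := kernel comb) Nsat.
- by move=> w /= w0 k; exists 0; rewrite w0 raddf0 scaler0.
- move=> w Nw; have [x ex] := Nw 1%N; exists (w - psX *: x), x.
  by rewrite subrK /= linearB linearZ /= ex expr1 subrr.
have [c ->] := Ng v vP; rewrite mulmx_sum_row.
by have := @in_sub_sum _ _ (kernel comb); apply=> i _; apply: in_subZ.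
Qed.

End Span.

End PowerSeries.

(** * Vanishing of Tor for X-regular modules *)

Section Tor.
Variable R : comNzRingType.
Local Notation S := (powser R).
Hypotheses (Rnoeth : noetherian R) (Rinj : injective_module (R^o : lmodType R)).

(** Saturation of the row space of [g] means that the cokernel of [g] is X-regular,
and the lemma says that its first Ext with values in S vanishes: [v] is a linear
form on the row space of [g], and [u] extends it to the free module. *)
Lemma dual_exact r k (g : 'M[S]_(r, k)) (v : 'cV[S]_r) :
  (forall (c : 'rV_k) (d : 'rV_r), psX R *: c = d *m g -> exists d', c = d' *m g) ->
  (forall d : 'rV_r, d *m g = 0 -> d *m v = 0) ->
  exists u : 'cV_k, v = g *m u.
Proof.
move=> gsat gv.
pose H (c : 'rV[S]_k) (f : S) := exists d : 'rV_r, c = d *m g /\ f = (d *m v) 0 0.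
have H0 : H 0 0 by exists 0; rewrite !mul0mx mxE.
have HP a x y f h : H x f -> H y h -> H (a *: x + y) (a * f + h).
  move=> [d [-> ->]] [d' [-> ->]]; exists (a *: d + d').
  rewrite !mulmxDl -!scalemxAl; split=> //.
  by rewrite [RHS]mxE [X in _ = X + _]mxE.
have Hfun f : H 0 f -> f = 0.
  by move=> [d [/esym/gv d0 ->]]; rewrite d0 mxE.
have Hsat b f : H (psX R *: b) f -> exists h, H b h.
  by move=> [d [/gsat[d' e] _]]; exists ((d' *m v) 0 0), d'.
have [|p [pH pX]] := extend_coef Rinj H0 HP Hfun Hsat (n := 0)
  (p := (\0 : {linear restrict _ -> R^o})).
  by move=> b f _; rewrite psXM0.
have [phi [phiH _]] := extend_linear Rinj H0 HP Hfun Hsat pH pX.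
exists (\col_l (phi (delta_mx 0 l) : S)); apply/colP => j.
rewrite -[LHS](phiH (row j g)); last first.
  by exists (delta_mx 0 j); rewrite -!rowE mxE.
rewrite {1}[row j g]row_sum_delta linear_sum mxE; apply: eq_bigr => l _.
by rewrite linearZ !mxE.
Qed.

(** The complex S^k -> S^r -> S^p given by the matrices [g] and [h] is exact by
[dual_exact], hence so is its dual with values in [I]. *)
Lemma injective_solve (I : lmodType S) r k (g : 'M[S]_(r, k)) (z : 'I_r -> I) :
  injective_module I ->
  (forall (c : 'rV_k) (d : 'rV_r), psX R *: c = d *m g -> exists d', c = d' *m g) ->
  (forall l, \sum_j g j l *: z j = 0) ->
  exists p (h : 'M[S]_(p, r)) (w : 'I_p -> I),
    h *m g = 0 /\ forall j, z j = \sum_i h i j *: w i.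
Proof.
move=> Iinj gsat gz; have [p [h [hg0 hgen]]] := syzygies_fg Rnoeth g.
have [||s [v [hv ->]]|W WP] := @injective_graph S I 'rV[S]_p
  (fun x s => exists v : 'cV_r, x = (h *m v)^T /\ s = comb z v^T) Iinj.
- by exists 0; rewrite mulmx0 !trmx0 raddf0.
- move=> a x y s t [v [-> ->]] [w [-> ->]]; exists (a *: v + w).
  by rewrite mulmxDr -scalemxAr !linearP.
- have [|u ->] := dual_exact gsat (v := v).
    move=> d /hgen[c ->]; rewrite -mulmxA (_ : h *m v = 0) ?mulmx0 //.
    by apply: trmx_inj; rewrite -hv trmx0.
  rewrite /comb.
  under eq_bigr => j _ do rewrite !mxE scaler_suml.
  rewrite exchange_big big1 // => l _ /=.
  under eq_bigr => j _ do rewrite mulrC -scalerA.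
  by rewrite -scaler_sumr gz scaler0.
exists p, h, (fun i => W (delta_mx 0 i)); split=> // j.
have -> : z j = comb z (delta_mx j (0 : 'I_1))^T.
  rewrite /comb (bigD1 j) //= big1 ?addr0 => [|i /negPf ij]; rewrite !mxE ?eqxx ?scale1r //.
  by rewrite ij scale0r.
have <- : W (col j h)^T = comb z (delta_mx j (0 : 'I_1))^T.
  by apply: WP; exists (delta_mx j 0); rewrite colE.
rewrite [(col j h)^T]row_sum_delta linear_sum; apply: eq_bigr => i _.
by rewrite linearZ !mxE.
Qed.

(** A tensor in the kernel involves finitely many elements [u l] of [F]; the
coefficient vectors whose combination of the [u l] lies in [K] form a saturated,
hence finitely generated, module.  Rewriting the tensor on the generators [kap i]
turns it into a system that [injective_solve] explains. *)
Lemma tensor_injective (K F M I : lmodType S) (f : {linear K -> F})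
  (q : {linear F -> M}) :
  injective f -> exact_at f q -> X_regular M -> injective_module I ->
  injective (tensor_map I f).
Proof.
move=> f_inj fq Mreg Iinj.
apply: raddf_inj => t /tensor_map_eq0[n [x [y [k [u [a [-> xu ay]]]]]]].
pose N := kernel (q \o comb u).
have Nsat : X_saturated N.
  by move=> v Nv; apply: Mreg; rewrite -[RHS]Nv linearZ.
have [r [g [gN Ng]]] := saturated_generators Rnoeth Nsat.
have /choice[kap kapP] i : exists z, f z = comb u (row i g) by apply/fq/gN.
have /choice[b bP] j : exists b : 'rV_r, \row_l a j l = b *m g.
  apply: Ng; apply/fq; exists (x j); rewrite xu /=.
  by apply: eq_bigr => l _; rewrite mxE.
have f_kap m (d : 'M_(m, r)) i : f (\sum_j d i j *: kap j) = comb u (row i (d *m g)).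
  rewrite linear_sum row_mul mulmx_sum_row linear_sum; apply: eq_bigr => j _.
  by rewrite !linearZ /= kapP mxE.
have x_kap j : x j = \sum_i b j 0 i *: kap i.
  apply: f_inj; rewrite f_kap -bP row_id xu; apply: eq_bigr => l _.
  by rewrite mxE.
pose z i := \sum_j b j 0 i *: y j.
have -> : \sum_j tensor_pure (x j) (y j) = \sum_i tensor_pure (kap i) (z i).
  under eq_bigr => j _ do rewrite x_kap linear_sumlz.
  rewrite exchange_big; apply: eq_bigr => i _ /=.
  rewrite linear_sumr; apply: eq_bigr => j _.
  by rewrite linearZl_LR linearZr_LR.
have [||p [h [w [hg0 zw]]]] := @injective_solve I r k g z Iinj.
- move=> c d e; apply: Ng; apply: Nsat; rewrite e mulmx_sum_row.
  by apply: in_sub_sum => i _; apply: in_subZ.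
- move=> l; rewrite -[RHS](ay l).
  under eq_bigr => i _ do rewrite scaler_sumr.
  rewrite exchange_big; apply: eq_bigr => j _ /=.
  have -> : a j l = \sum_i b j 0 i * g i l.
    by have := congr1 (fun v : 'rV_k => v 0 l) (bP j); rewrite !mxE.
  by rewrite scaler_suml; apply: eq_bigr => i _; rewrite scalerA mulrC.
under eq_bigr => i _ do rewrite zw linear_sumr.
rewrite exchange_big big1 // => i _ /=.
under eq_bigr => j _ do rewrite linearZr_LR -linearZl_LR.
rewrite -linear_sumlz (_ : \sum_j _ = 0) ?linear0l //.
by apply: f_inj; rewrite f_kap hg0 row0 !raddf0.
Qed.

End Tor.

(** * Free covers and embeddings into reduced products *)

(** The free module on the underlying set of [M], with its evaluation onto [M]. *)
Section FreeModule.
Variables (A : comNzRingType) (M : lmodType A).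

Definition finitely_supported (f : M -> A^o) := exists s : seq M, forall x, x \notin s -> f x = 0.
Let fs0 : finitely_supported 0. Proof. by exists [::]. Qed.
Let fsP a f g : finitely_supported f -> finitely_supported g ->
  finitely_supported (a *: f + g).
Proof.
move=> [s sP] [t tP]; exists (s ++ t) => x; rewrite mem_cat negb_or => /andP[xs xt].
by rewrite addrfctE scalrfctE sP // tP // scaler0 addr0.
Qed.
Definition free_module : lmodType A := sub_mod (Submodule fs0 fsP).

Definition coord (f : free_module) : M -> A^o := sub_val f.

Lemma coordP a f g x : coord (a *: f + g) x = a * coord f x + coord g x.
Proof. by rewrite /coord linearP. Qed.

Lemma coord_sum n (f : 'I_n -> free_module) (a : 'I_n -> A) x :
  coord (\sum_i a i *: f i) x = \sum_i a i * coord (f i) x.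
Proof.
by rewrite /coord linear_sum fct_sumE; apply: eq_bigr => i _; rewrite linearZ.
Qed.

Definition support (f : free_module) : seq M := undup (projT1 (cid (sub_val_in f))).

Lemma supportP f x : x \notin support f -> coord f x = 0.
Proof. by rewrite mem_undup; case: cid => /= s; apply. Qed.

Lemma free_basis x : exists f, coord f = fun y => (y == x)%:R.
Proof.
apply: (@sub_valP _ _ (Submodule fs0 fsP)).
by exists [:: x] => y; rewrite inE => /negPf->.
Qed.

Definition free_eval (f : free_module) : M := \sum_(x <- support f) coord f x *: x.

Lemma free_evalE f s : uniq s -> (forall x, x \notin s -> coord f x = 0) ->
  free_eval f = \sum_(x <- s) coord f x *: x.
Proof.
move=> us sP; rewrite /free_eval.
have nz t : \sum_(x <- t) coord f x *: x =
    \sum_(x <- [seq x <- t | coord f x != 0]) coord f x *: x.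
  rewrite [RHS]big_filter [RHS]big_mkcond; apply: eq_bigr => x _.
  by case: eqP => // ->; rewrite scale0r.
rewrite nz [RHS]nz; apply: perm_big; apply: uniq_perm; rewrite ?filter_uniq ?undup_uniq //.
move=> x; rewrite !mem_filter; case: eqP => //= fx.
by apply/idP/idP => _; apply: contrapT => /negP; [move/sP|move/supportP].
Qed.

Let free_eval_linear : linear free_eval.
Proof.
move=> a f g; pose s := undup (support f ++ support g).
have fP x : x \notin s -> coord f x = 0.
  by rewrite mem_undup mem_cat negb_or => /andP[/supportP].
have gP x : x \notin s -> coord g x = 0.
  by rewrite mem_undup mem_cat negb_or => /andP[_ /supportP].
rewrite !(@free_evalE _ s) ?undup_uniq // => [|x xs].
  rewrite scaler_sumr -big_split; apply: eq_bigr => x _ /=.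
  by rewrite coordP scalerDl scalerA.
by rewrite coordP fP // gP // mulr0 addr0.
Qed.
HB.instance Definition _ := GRing.isLinear.Build A free_module M _ free_eval free_eval_linear.

Lemma free_eval_surj : surjective_map free_eval.
Proof.
move=> x; have [f fx] := free_basis x; exists f.
rewrite (@free_evalE _ [:: x]) // => [|y]; first by rewrite big_seq1 fx eqxx scale1r.
by rewrite inE fx => /negPf->.
Qed.

(** Finitely many elements are combinations of finitely many basis vectors, and an
equation between them holds coordinate by coordinate. *)
Lemma free_flat : equationally_flat free_module.
Proof.
move=> n k y a ay; pose s := undup (flatten [seq support (y i) | i <- enum 'I_n]).
have sP i x : x \notin s -> coord (y i) x = 0.
  move=> xs; apply: supportP; apply: contra xs => xi; rewrite mem_undup.
  by apply/flattenP; exists (support (y i)) => //; apply: map_f; rewrite mem_enum.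
have [w wP] := choice (fun j : 'I_(size s) => free_basis s`_j).
exists (size s), w, (fun i j => coord (y i) s`_j); split=> [i|l j].
  apply: sub_val_inj; apply/funext => x; rewrite -!/(coord _) coord_sum.
  have [xs|xs] := boolP (x \in s).
    have lx : (index x s < size s)%N by rewrite index_mem.
    rewrite (bigD1 (Ordinal lx)) //= wP nth_index // eqxx mulr1 big1 ?addr0 // => j jx.
    rewrite wP; case: eqP => [xj|_]; last by rewrite mulr0.
    by case/eqP: jx; apply: val_inj; rewrite /= xj index_uniq ?undup_uniq.
  rewrite sP // big1 // => j _; rewrite wP; case: eqP => [xj|_]; last by rewrite mulr0.
  by case/negP: xs; rewrite xj mem_nth.
by rewrite -coord_sum ay /coord raddf0.
Qed.

End FreeModule.

Section ReducedProduct.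
Variable R : comNzRingType.
Local Notation S := (powser R).
Variable M : lmodType S.

Definition span (s : seq M) : submodule M := range_sub (comb (fun i : 'I_(size s) => s`_i)).

Lemma span_mem s x : x \in s -> span s x.
Proof.
move=> /(nthP 0)[i lis <-]; exists (delta_mx 0 (Ordinal lis)).
rewrite /= /comb (bigD1 (Ordinal lis)) //= big1 => [|j /negPf ji];
  rewrite !mxE ?eqxx ?scale1r ?addr0 //.
by rewrite ji scale0r.
Qed.

(** Functionals on the finitely generated submodules of [M] serve as indices; an
element of [M] is evaluated at all those indices whose submodule contains it. *)
Definition functional : Type := {s : seq M & {linear sub_mod (span s) -> S^o}}.

Definition apply_functional (w : functional) (x : M) : S^o :=
  if insub x is Some y then projT2 w y else 0.

Lemma apply_functionalE (w : functional) (y : sub_mod (span (projT1 w))) :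
  apply_functional w (sub_val y) = projT2 w y.
Proof. by rewrite /apply_functional /sub_val valK. Qed.

Definition eventually_zero (f : functional -> S^o) : Prop :=
  exists s : seq M, forall w : functional, {subset s <= projT1 w} -> f w = 0.
Let ez0 : eventually_zero 0. Proof. by exists [::]. Qed.
Let ezP a f g : eventually_zero f -> eventually_zero g -> eventually_zero (a *: f + g).
Proof.
move=> [s sP] [t tP]; exists (s ++ t) => w st.
rewrite addrfctE scalrfctE sP ?tP ?scaler0 ?addr0 // => x xs; apply: st;
  by rewrite mem_cat xs ?orbT.
Qed.

(** Two families have the same germ if they agree at all functionals whose domain
is large enough.  Each element of [M] belongs to all large domains, so that its
evaluation is linear although each functional is only partially defined. *)
Definition germs : submodule (functional -> S^o) := Submodule ez0 ezP.
Definition reduced_product : lmodType S := quot_mod germs.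

Definition evaluation (x : M) : reduced_product :=
  quot_pi germs (fun w => apply_functional w x).

Let evaluation_linear : linear evaluation.
Proof.
move=> a x y; rewrite /evaluation -linearP; apply/quot_pi_eq.
exists [:: x; y] => w xy; have xw : span (projT1 w) x by apply/span_mem/xy; rewrite mem_head.
have yw : span (projT1 w) y by apply/span_mem/xy; rewrite !inE eqxx orbT.
have [x' <-] := sub_valP xw; have [y' <-] := sub_valP yw.
rewrite -[LHS]/(apply_functional w (a *: sub_val x' + sub_val y') -
  (a *: apply_functional w (sub_val x') + apply_functional w (sub_val y'))).
by rewrite -linearP !apply_functionalE linearP subrr.
Qed.
HB.instance Definition _ :=
  GRing.isLinear.Build S M reduced_product _ evaluation evaluation_linear.

Hypothesis Rnoeth : noetherian R.

(** The equations hold at all functionals with a large domain, and there they are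
solved by the same finite set of generating syzygies of [a]. *)
Lemma reduced_product_flat : equationally_flat reduced_product.
Proof.
move=> n k y a ay; have [f fy] := choice (fun i => quot_piP (y i)).
have /choice[s sP] l : exists s : seq M, forall w : functional, {subset s <= projT1 w} ->
    \sum_i a i l * (f i w : S) = 0.
  have /quot_pi0[s sP] : quot_pi germs (\sum_i a i l *: f i) = 0.
    by rewrite linear_sum -[RHS](ay l); apply: eq_bigr => i _; rewrite fy linearZ.
  by exists s => w /sP; rewrite fct_sumE.
have [r [g [ga gP]]] := syzygies_fg Rnoeth (\matrix_(i, l) a i l).
pose t := flatten [seq s l | l <- enum 'I_k].
have /choice[c cP] (w : functional) : exists c : 'rV_r, {subset t <= projT1 w} ->
    \row_i (f i w : S) = c *m g.
  have [tw|tw] := pselect {subset t <= projT1 w}; last by exists 0 => /tw.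
  have [|c ->] := gP (\row_i (f i w : S)); last by exists c.
  apply/rowP => l; rewrite !mxE -[RHS](sP l w) => [|x xl].
    by apply: eq_bigr => i _; rewrite !mxE mulrC.
  by apply: tw; apply/flattenP; exists (s l) => //; apply: map_f; rewrite mem_enum.
exists r, (fun j => quot_pi germs (fun w => c w 0 j : S^o)), (fun i j => g j i).
split=> [i|l j].
  rewrite fy; under eq_bigr => j _ do rewrite -linearZ /=.
  rewrite -linear_sum; apply/quot_pi_eq; exists t => w /cP ew.
  rewrite -[LHS]/(f i w - (\sum_j (fun u => g j i *: (c u 0 j : S^o) : S^o)) w) fct_sumE.
  apply/eqP; rewrite subr_eq0; apply/eqP.
  have := congr1 (fun v : 'rV_n => v 0 i) ew; rewrite !mxE => ->.
  by apply: eq_bigr => j _; rewrite mulrC.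
have := congr1 (fun v : 'M_(r, k) => v j l) ga; rewrite !mxE => gal; rewrite -[RHS]gal.
by apply: eq_bigr => i _; rewrite mxE mulrC.
Qed.

End ReducedProduct.

Section Embedding.
Variables (R : comNzRingType) (m : {pred R}).
Hypotheses (R_local : local_ring m) (R_QF : quasi_Frobenius R).
Local Notation S := (powser R).

(** If [b] is not divisible by X, some R-linear form vanishing on X B is nonzero at
[b], because R is a cogenerator; it lifts to an S-linear form having it as constant
coefficient. *)
Lemma functionals_detect (B : lmodType S) (b : B) : X_regular B ->
  (forall phi : {linear B -> S^o}, (phi b : S) 0%N = 0) -> exists c, b = psX R *: c.
Proof.
move=> Breg b0; apply: contrapT => bX; have [Rnoeth Rinj] := R_QF.
pose XB (x : restrict B) := exists c : B, x = psX R *: c.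
have XB0 : XB 0 by exists 0; rewrite scaler0.
have XBP a x y : XB x -> XB y -> XB (a *: x + y).
  move=> [c ->] [d ->]; exists (psC a *: c + d).
  by rewrite scalerDr scalerA mulrC -scalerA.
have [p [pX pb]] := cogenerator R_local R_QF (N := Submodule XB0 XBP) bX.
have [|||||c|phi [_ phip]] := @extend_linear R Rinj B (fun x f => x = 0 /\ f = 0) _ _ _ _ p.
- by [].
- by move=> a x y f g [-> ->] [-> ->]; rewrite scaler0 mulr0 !addr0.
- by move=> f [].
- by move=> x f [/Breg-> _]; exists 0.
- by move=> x f [-> ->]; rewrite raddf0.
- by apply: pX; exists c.
by case/eqP: pb; rewrite -phip.
Qed.

Variables (M : lmodType S).
Hypothesis Mreg : X_regular M.

Let span_regular s : X_regular (sub_mod (span (M := M) s)).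
Proof. exact: sub_mod_regular. Qed.

(** If all functionals on a large domain vanish at [x], then [x] is divisible by X
with a quotient that they annihilate too, hence by all powers of X. *)
Lemma evaluation_inj : injective (@evaluation R M).
Proof.
apply: raddf_inj => x x_ev0; have /quot_pi0[s0 s0P] :
    quot_pi (germs M) (fun w => apply_functional w x) = 0 by [].
pose s := x :: s0.
have [x' ex] := sub_valP (span_mem (mem_head x s0)).
have x0 (phi : {linear sub_mod (span s) -> S^o}) : phi x' = 0.
  pose w : functional M := existT _ s phi.
  rewrite -[LHS](apply_functionalE (w := w)) ex; apply: s0P => y /= ys.
  by rewrite inE ys orbT.
have Xdiv k : exists y, x' = psX R ^+ k *: y /\
    forall phi : {linear sub_mod (span s) -> S^o}, phi y = 0.
  elim: k => [|k [y [-> yP]]]; first by exists x'; rewrite scale1r.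
  have [|c yc] := functionals_detect (b := y) (@span_regular s).
    by move=> phi; rewrite yP.
  exists c; rewrite yc scalerA -exprSr; split=> // phi; apply: psXI.
  by have := yP phi; rewrite yc linearZ.
have [v ev] := sub_val_in x'; rewrite -ex -ev; apply: krull => //.
  by case: R_QF.
move=> k; have [y [ey _]] := Xdiv k; have [w ew] := sub_val_in y.
by exists w; rewrite ev ew ey linearZ.
Qed.

(** If X times a germ is the evaluation of [x], then every functional on a large
domain is divisible by X at [x], hence so is [x] itself. *)
Lemma evaluation_coker_regular :
  X_regular (quot_mod (range_sub (@evaluation R M))).
Proof.
have [Rnoeth Rinj] := R_QF.
have Freg : X_regular (reduced_product M).
  exact/flat_X_regular/equationally_flatP/reduced_product_flat.
move=> q; have [f ->] := quot_piP q; rewrite -linearZ => /quot_pi0[x xf].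
have [phi ef] := quot_piP f; rewrite ef -linearZ in xf.
have /quot_pi_eq[s0 s0P] := xf; pose s := x :: s0.
have [x' ex] := sub_valP (span_mem (mem_head x s0)).
have [|c xc] := functionals_detect (b := x') (@span_regular s).
  move=> psi; pose w : functional M := existT _ s psi.
  have : apply_functional w x - psX R * (phi w : S) = 0.
    by apply: s0P => y ys; rewrite inE ys orbT.
  rewrite -{1}ex apply_functionalE => /eqP; rewrite subr_eq0 => /eqP ->.
  exact: psXM0.
apply/quot_pi0; exists (sub_val c); apply/eqP; rewrite -subr_eq0; apply/eqP/Freg.
by rewrite scalerBr -linearZ -sub_valZ -xc ex ef -linearZ xf subrr.
Qed.

End Embedding.

(** * Gorenstein flat modules *)

Lemma exact_splice_tensor (A : comNzRingType) (P K B C D N : lmodType A)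
  (p : {linear P -> K}) (i : {linear K -> B}) (q : {linear B -> C})
  (j : {linear C -> D}) :
  surjective_map p -> exact_at i q -> surjective_map q ->
  injective (tensor_map N j) ->
  exact_at (tensor_map N (i \o p)) (tensor_map N (j \o q)).
Proof.
move=> pS iq qS j_inj t.
have := @exact_splice _ _ _ _ _ _ (tensor_map N p) (tensor_map N i) (tensor_map N q)
  (tensor_map N j) (tensor_map_surj pS) (tensor_right_exact iq qS) j_inj t.
move=> /= [t0 t0']; split.
  rewrite tensor_map_comp => /t0[s es]; exists s.
  by rewrite tensor_map_comp.
by move=> [s es]; rewrite tensor_map_comp; apply: t0'; exists s;
  rewrite -tensor_map_comp.
Qed.

Lemma quot_pi_surj (A : comNzRingType) (V : lmodType A) (N : submodule V) :
  surjective_map (quot_pi N).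
Proof. by move=> q; have [v ->] := quot_piP q; exists v. Qed.

(** Short exact sequences that stay exact after tensoring with an injective module;
right exactness being automatic, only injectivity is asked. *)
Definition injectively_pure_exact (A : comNzRingType) (K B C : lmodType A)
    (f : {linear K -> B}) (g : {linear B -> C}) : Prop :=
  [/\ injective f, exact_at f g, surjective_map g &
    forall I : lmodType A, injective_module I -> injective (tensor_map I f)].

(** The complete resolution is spliced from the short exact sequences
0 -> L_{n+1} -> P_n -> L_n -> 0 on the left and 0 -> L_0 -> Q_0 -> U_0 -> 0,
0 -> U_n -> Q_{n+1} -> U_{n+1} -> 0 on the right. *)
Lemma Gorenstein_flat_splice (A : comNzRingType) (L P Q U : nat -> lmodType A)
  (i : forall n, {linear L n.+1 -> P n}) (p : forall n, {linear P n -> L n})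
  (j0 : {linear L 0%N -> Q 0%N}) (q : forall n, {linear Q n -> U n})
  (j : forall n, {linear U n -> Q n.+1}) :
  (forall n, flat (P n)) -> (forall n, flat (Q n)) ->
  (forall n, injectively_pure_exact (i n) (p n)) ->
  injectively_pure_exact j0 (q 0%N) ->
  (forall n, injectively_pure_exact (j n) (q n.+1)) ->
  Gorenstein_flat (L 0%N).
Proof.
move=> Pflat Qflat ip jq0 jq.
exists {| lower := P; upper := Q; lower_map n := i n \o p n.+1;
          middle_map := j0 \o p 0%N; upper_map n := j n \o q n |}.
have [j0_inj j0q qS0 j0I] := jq0.
split=> //.
- split=> [n|||n] /=; apply: exact_splice => //.
  + by case: (ip n.+2).
  + by case: (ip n.+1).
  + by case: (ip n).
  + by case: (ip 1%N).
  + by case: (ip 0%N).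
  + by case: (ip 0%N).
  + by case: (jq 0%N).
  + by case: n => // n; case: (jq n).
  + by case: (jq n).
  + by case: (jq n.+1).
- exists j0; split=> // y; split=> -[x <-]; last by exists (p 0%N x).
  by have [_ _ /(_ x)[z <-] _] := ip 0%N; exists z.
- move=> I Iinj; split=> [n|||n] /=; apply: exact_splice_tensor => //.
  + by case: (ip n.+2).
  + by case: (ip n.+1).
  + by case: (ip n.+1).
  + by case: (ip n) => _ _ _; apply.
  + by case: (ip 1%N).
  + by case: (ip 0%N).
  + by case: (ip 0%N).
  + exact: j0I.
  + by case: (ip 0%N).
  + by case: (jq 0%N) => _ _ _; apply.
  + by case: n => // n; case: (jq n).
  + by case: (jq n).
  + by case: (jq n).
  + by case: (jq n.+1) => _ _ _; apply.
Qed.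

Section Gorenstein.
Variables (R : comNzRingType) (m : {pred R}).
Hypotheses (R_local : local_ring m) (R_QF : quasi_Frobenius R).
Local Notation S := (powser R).

Definition syzygy (M : lmodType S) : lmodType S := sub_mod (kernel (@free_eval _ M)).
Definition cosyzygy (M : lmodType S) : lmodType S :=
  quot_mod (range_sub (@evaluation R M)).

Lemma free_regular (M : lmodType S) : X_regular (free_module M).
Proof. exact/flat_X_regular/equationally_flatP/free_flat. Qed.

Lemma syzygy_regular (M : lmodType S) : X_regular (syzygy M).
Proof. exact/sub_mod_regular/free_regular. Qed.

Lemma syzygy_exact (M : lmodType S) : X_regular M ->
  injectively_pure_exact (sub_val : {linear syzygy M -> free_module M}) (@free_eval _ M).
Proof.
have [Rnoeth Rinj] := R_QF => Mreg; split.
- exact: sub_val_inj.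
- exact: exact_kernel.
- exact: free_eval_surj.
- move=> I Iinj; apply: (tensor_injective Rnoeth Rinj _ (exact_kernel _)) => //.
Qed.

Lemma cosyzygy_exact (M : lmodType S) : X_regular M ->
  injectively_pure_exact (@evaluation R M)
    (quot_pi _ : {linear reduced_product M -> cosyzygy M}).
Proof.
have [Rnoeth Rinj] := R_QF => Mreg.
have ev_inj := @evaluation_inj _ _ R_local R_QF _ Mreg.
split=> //; [exact: exact_cokernel|exact: quot_pi_surj|].
move=> I Iinj; apply: (tensor_injective Rnoeth Rinj _ (exact_cokernel _)) => //.
exact: (@evaluation_coker_regular _ _ R_local R_QF _ Mreg).
Qed.

(** Kernels of free covers and cokernels of evaluations are X-regular again, so both
constructions iterate. *)
Lemma X_regular_Gorenstein_flat (M : lmodType S) : X_regular M -> Gorenstein_flat M.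
Proof.
move=> Mreg; have [Rnoeth _] := R_QF.
pose L n := iter n syzygy M; pose U n := iter n cosyzygy M.
have Lreg n : X_regular (L n) by case: n => // n; apply: syzygy_regular.
have Ureg n : X_regular (U n).
  by elim: n => // n; apply: (@evaluation_coker_regular _ _ R_local R_QF).
apply: (@Gorenstein_flat_splice _ L (fun n => free_module (L n))
  (fun n => reduced_product (U n)) (fun n => U n.+1)
  (fun n => sub_val) (fun n => @free_eval _ (L n))
  (@evaluation R M) (fun n => quot_pi _) (fun n => @evaluation R (U n.+1))).
- by move=> n; apply/equationally_flatP/free_flat.
- by move=> n; apply/equationally_flatP/reduced_product_flat.
- by move=> n; apply: syzygy_exact.
- exact: cosyzygy_exact.
- by move=> n; apply: (@cosyzygy_exact (U n.+1)).
Qed.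

(** A Gorenstein flat module is a submodule of a flat one. *)
Lemma Gorenstein_flat_X_regular (M : lmodType S) : Gorenstein_flat M -> X_regular M.
Proof.
move=> [F [_ Fflat _ [j [j_inj _]] _]] x x0; apply: j_inj.
rewrite raddf0; apply: (flat_X_regular (Fflat 0%N)).
by rewrite -linearZ x0 raddf0.
Qed.

Lemma Gflat_resolution1 (M : lmodType S) : has_Gflat_resolution M 1.
Proof.
pose Z : lmodType S := 'rV[S]_0.
have Z0 (x : Z) : x = 0 by apply/rowP => -[].
pose G n : lmodType S := match n with 0%N => free_module M | 1%N => syzygy M | _ => Z end.
pose d n : {linear G n.+1 -> G n} := match n with
  | 0%N => (sub_val : {linear syzygy M -> free_module M})
  | 1%N => (\0 : {linear Z -> syzygy M}) | _.+2 => (\0 : {linear Z -> Z}) end.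
exists G, d, (@free_eval _ M); split.
- case=> [|[|//]] _; apply: X_regular_Gorenstein_flat.
    exact: free_regular.
  exact: syzygy_regular.
- by case=> [|[|n]] // _ x; apply: Z0.
- case=> [|n] /= y.
    split=> [y0|[x <-]]; last by rewrite raddf0.
    by exists 0; rewrite raddf0; apply: sub_val_inj; rewrite y0 raddf0.
  by split=> _; [exists 0|]; case: n y => [|n] y; rewrite ?[y]Z0 ?raddf0.
- exact: exact_kernel.
- exact: free_eval_surj.
Qed.

(** The module S/XS is not X-regular, so it has no resolution of length 0. *)
Lemma Gwdim_powser : Gwdim S = Some 1%N.
Proof.
apply/leastP; split=> [M|k Gk].
  rewrite /le_option; case e: (Gfd M) => [i|].
    by have /leastP[_] := e; apply; apply: Gflat_resolution1.
  move: e; rewrite /Gfd /least; case: pselect => // nex _; apply: nex.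
  by exists 1%N; apply/asboolP/Gflat_resolution1.
case: k Gk => // Gk.
pose mulX : {linear S^o -> S^o} := *:%R (psX R).
have := Gk (quot_mod (range_sub mulX)); rewrite /le_option.
case e: (Gfd _) => [[|i]|] // _; have /leastP[[G [d [p [Gflat G0 _ dp pS]]]] _] := e.
have G0reg := Gorenstein_flat_X_regular (Gflat 0%N (leqnn 0)).
have p_inj x : p x = 0 -> x = 0.
  by move=> /dp[y <-]; rewrite [y](G0 1%N) ?raddf0.
have [x px] := pS (quot_pi (range_sub mulX) 1).
have Xx : psX R *: x = 0.
  apply: p_inj; rewrite linearZ px -linearZ; apply/quot_pi0.
  by exists 1.
have /quot_pi0[f f1] : quot_pi (range_sub mulX) 1 = 0 by rewrite -px (G0reg _ Xx) raddf0.
have := psXM0 f; by rewrite [psX R * f]f1 => /eqP; rewrite oner_eq0.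
Qed.

End Gorenstein.

(** * Failure of arithmeticity *)

Section NotArithmetical.
Variables (R : comNzRingType) (m : {pred R}).
Hypotheses (R_local : local_ring m) (R_not_field : ~ is_field R).
Local Notation S := (powser R).

Definition ps_maximal : {pred S} := fun f => ps0 f \in m.

Lemma local_addl x y : x \in m -> y \in m -> x + y \in m.
Proof. by have [_ _ mP] := local_ideal R_local => xm ym; rewrite -[x]mul1r mP. Qed.

Lemma local_mull a x : x \in m -> a * x \in m.
Proof. by have [m0 _ mP] := local_ideal R_local => xm; rewrite -[_ * _]addr0 mP. Qed.

Lemma local_cancel a b : a \notin m -> a * b \in m -> b \in m.
Proof.
by move=> /(local_unit R_local)[c ca] abm; rewrite -[b]mul1r -ca -mulrA local_mull.
Qed.

Lemma local_cancel0 a b : a \notin m -> a * b = 0 -> b = 0.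
Proof.
by move=> /(local_unit R_local)[c ca] ab0; rewrite -[b]mul1r -ca -mulrA ab0 mulr0.
Qed.

Let ps_maximal_ideal : idealr_closed ps_maximal.
Proof.
have [m0 m1 mP] := local_ideal R_local; split=> //.
move=> a f g fm gm; rewrite unfold_in /= rmorphD rmorphM.
by apply: local_addl => //; apply: local_mull.
Qed.
Let ps_maximal_prime : prime_idealr_closed ps_maximal.
Proof.
move=> f g; rewrite !unfold_in rmorphM => fgm.
apply/orP; have [fm|fm] := boolP (ps0 f \in m); first by left.
by right; apply: local_cancel fm fgm.
Qed.
Let P : prime_idealr S := HB.pack ps_maximal
  (isIdealr.Build S ps_maximal ps_maximal_ideal)
  (isPrimeIdealrClosed.Build S ps_maximal ps_maximal_prime).

Let denomP (u : denom P) : ps0 (val u) \notin m.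
Proof. exact: (valP u). Qed.

(** Let x / s generate the localisation of (a, X).  Clearing denominators gives
[a U = V x] and [X W = D x] with [U] and [W] outside the maximal ideal.  In degree 0
the second equation reads [D_0 x_0 = 0]; in degree 1 it makes [D_0] a unit, because
x_0 is a multiple of a and lies in [m].  Hence [x_0 = 0], and the first equation
gives [a U_0 = 0]. *)
Lemma powser_not_arithmetical : ~ arithmetical S.
Proof.
have [a a0 am] : exists2 a, a != 0 & a \in m.
  apply: contrapT => ma; apply: R_not_field => a a0; apply: contrapT => na.
  apply: ma; exists a => //; apply: (local_nonunit R_local) => b.
  by apply/eqP => e; apply: na; exists b.
move=> /(_ [:: psC a; psX R] P)[z zP].
have : z \in ideal_gen [:: z] by rewrite mem_ideal_gen ?mem_head.
rewrite -zP => /asboolP[x [s [/asboolP[c]]]].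
rewrite !big_ord_recl big_ord0 addr0 /=.
move=> xE zE.
have gen y : y \in ideal_gen [:: psC a; psX R] ->
    exists U V : S, ps0 U \notin m /\ y * U = V * x.
  move=> yI; have : locfrac y (denom1 P) \in ideal_gen [:: z].
    by rewrite -zP; apply/asboolP; exists y, (denom1 P).
  move=> /asboolP[d]; rewrite big_ord1 /= zE.
  have [w [t ->]] := locfrac_surj (d 0).
  rewrite [_ * _]loc_mulE => /locfracP[u /=]; rewrite mulr1 => e.
  exists (val u * (val t * val s)), (val u * w); split.
    exact: (denomP (denomM u (denomM t s))).
  by apply/eqP; rewrite -subr_eq0 mulrCA -mulrA -mulrBr e.
have x0m : x 0%N \in m by rewrite xE psD !psM0 mulr0 addr0; apply: local_mull.
have [U [V [Um eU]]] : exists U V : S, ps0 U \notin m /\ psC a * U = V * x.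
  by apply/gen/mem_ideal_gen; rewrite mem_head.
have [W [D [Wm eW]]] : exists U V : S, ps0 U \notin m /\ psX R * U = V * x.
  by apply/gen/mem_ideal_gen; rewrite !inE eqxx orbT.
have D0 : D 0%N * x 0%N = 0 by rewrite -psM0 -eW psXM0.
have D1 : W 0%N = D 0%N * x 1%N + D 1%N * x 0%N.
  by rewrite -psXMS eW psM !big_ord_recl big_ord0 addr0.
have D0m : D 0%N \notin m.
  apply: contra Wm => D0m; rewrite /ps0 D1; apply: local_addl.
    by rewrite mulrC; apply: local_mull.
  exact: local_mull.
have x0 := local_cancel0 D0m D0; case/eqP: a0; apply: (local_cancel0 Um).
have := congr1 (fun f : S => f 0%N) eU; rewrite !psM0 x0 mulr0 mulrC; exact.
Qed.

End NotArithmetical.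

Theorem theorem2p12 (R : comNzRingType) (m : {pred R})
  (R_local : local_ring m) (R_QF : quasi_Frobenius R)
  (R_not_field : ~ is_field R) :
  Gwdim (powser R) = Some 1%N /\ ~ arithmetical (powser R).
Proof.
by split; [apply: Gwdim_powser R_local R_QF|apply: powser_not_arithmetical R_local _].
Qed.
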